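(* Let $C$ be a $\zeta$-regular Cantor set with a regular ultrametric $d$. Then the measure $\mu$ coming from the $\zeta$-function defines a measure $\nu$ on the space of choices $\Upsilon(C)$ (the probability measure $\nu$ built from $\mu$ as described in the context). Moreover, for all $s\in\mathbb R$ there is a closable Dirichlet form on the Hilbert space $L^2(C,\mu)$ defined by $$Q_s(f,g):=\frac12\int_{\Upsilon(C)}\mathrm{Tr}\big(|D|^{-s}[D,\pi_\tau(f)]^*[D,\pi_\tau(g)]\big)\,d\nu(\tau),$$ with $\mathrm{Dom}(Q_s)=\mathcal E$ a dense subspace of the real Hilbert space $L^2(C,\mu)$.
   Context: A Cantor set is a totally disconnected compact metrizable space without isolated points. A metric $d$ on $C$ is regular if it induces the topology of $C$, and it is an ultrametric if $d(x,y)\le\max\{d(x,z),d(z,y)\}$ for all $x,y,z$. Let $\mathcal{V}$ be the vertex set of the reduced weighted rooted tree (Michon tree) of $(C,d)$: the vertices correspond to the distinct subsets of $C$ of the form $\{y: d(x,y)<\epsilon\}$ ($x\in C$, $\epsilon>0$); the root is $C$; the children of a vertex are the maximal vertices strictly contained in it. For $v\in\mathcal V$, $[v]\subset C$ denotes the corresponding subset; it is clopen with $\mathrm{diam}[v]>0$, and $\mathcal V$ is countable. $\mathcal G_v$ is the set of ordered pairs $(w,w')$ of distinct children of $v$. A choice function is a map $\tau:\mathcal V\to C\times C$, $\tau(v)=(\tau_+(v),\tau_-(v))$, with $\tau_\pm(v)\in[v]$ and $d(\tau_+(v),\tau_-(v))=\mathrm{diam}[v]$. $\Upsilon(C)$ is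 the set of choice functions. Since $x,y\in[v]$ satisfy $d(x,y)=\mathrm{diam}[v]$ iff they lie in distinct children of $v$, one has $\Upsilon(C)=\prod_{v\in\mathcal V}\Upsilon_v(C)$ with $\Upsilon_v(C)=\bigsqcup_{(w,w')\in\mathcal G_v}[w]\times[w']$. $\mathcal{C}_{\mathrm{Lip}}(C)$ is the algebra of complex-valued Lipschitz functions on $(C,d)$. On $\mathcal H=\ell^2(\mathcal V)\otimes\mathbb C^2$ let $(D\psi)(v)=(\mathrm{diam}[v])^{-1}\sigma_1\psi(v)$ with $\sigma_1=\begin{pmatrix}0&1\\1&0\end{pmatrix}$, and $(\pi_\tau(f)\psi)(v)=\mathrm{diag}\{f(\tau_+(v)),f(\tau_-(v))\}\psi(v)$. Let $s_0$ be the abscissa of convergence of $\mathrm{Tr}(|D|^{-s})=2\sum_{v}(\mathrm{diam}[v])^s$. $(C,d)$ is $\zeta$-regular if $s_0$ is finite, $\lim_{s\downarrow s_0}(s-s_0)\mathrm{Tr}(|D|^{-s})>0$, and for every $f\in\mathcal{C}_{\mathrm{Lip}}(C)$ and $\tau\in\Upsilon(C)$ the limit $\mu(f)=\lim_{s\downarrow s_0}\mathrm{Tr}(|D|^{-s}\pi_\tau(f))/\mathrm{Tr}(|D|^{-s})$ exists. This limit is independent of $\tau$ and defines a probability measure $\mu$ on $C$, the measure coming from the $\zeta$-function. The measure $\nu$ is the probability measure on $\Upsilon(C)=\prod_v\Upsilon_v(C)$ obtained by the Kolmogorov consistency theorem (product measure) from the measures $$\nu_v=\frac{\mu\times\mu}{\sum_{(w,w')\in\mathcal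 G_v}\mu([w])\mu([w'])}\quad\text{on }\Upsilon_v(C).$$ $\mathcal E\subset L^2(C,\mu)$ is the real linear span of the characteristic functions $\chi_v$ of $[v]$, $v\in\mathcal V$. ''Closable Dirichlet form'' means a non-negative definite symmetric bilinear form, densely defined, which is closable and Markovian. A symmetric form $Q$ with domain $\mathrm{Dom}(Q)$ is closable if for every sequence $(f_n)$ in $\mathrm{Dom}(Q)$ with $\|f_n\|_{L^2}\to0$ and $Q(f_n-f_m,f_n-f_m)\to0$ as $n,m\to\infty$ one has $Q(f_n,f_n)\to0$. The Markovian property is taken in the form $Q(\tilde f,\tilde f)\le Q(f,f)$ for $f\in\mathrm{Dom}(Q)$, where $\tilde f=\min(\max(0,f),1)$.
   Formalization: The formal theorem additionally assumes that for every vertex v the denominator of ν_v, the sum of μ([w])μ([w']) over pairs of distinct children, is nonzero; ζ-regularity alone does not ensure this, and otherwise ν_v is 0/0. *)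

(* Defs.v *)
From HB Require Import structures.
From mathcomp Require Import all_boot all_order all_algebra.
From mathcomp Require Import all_classical all_reals all_analysis.
From mathcomp Require Import complex lra.
Set Implicit Arguments.
Unset Strict Implicit.
Unset Printing Implicit Defensive.
Import Order.TTheory GRing.Theory Num.Theory.
Import numFieldNormedType.Exports.
Local Open Scope classical_set_scope.
Local Open Scope ring_scope.
Local Open Scope complex_scope.

Section regular_metrics.
Context {R : realType} {C : topologicalType}.
Implicit Types d : C -> C -> R.

Definition is_metric d :=
  [/\ forall x y, d x y = 0 <-> x = y,
      forall x y, d x y = d y x &
      forall x y z, d x y <= d x z + d z y].

Definition dball d (x : C) (e : R) : set C := [set y | d x y < e].

Definition induces_topology d :=
  forall (x : C) (A : set C),
    nbhs x A <-> exists2 e : R, 0 < e & dball d x e `<=` A.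

Definition regular_metric d := is_metric d /\ induces_topology d.

Definition ultrametric d :=
  forall x y z, d x y <= Num.max (d x z) (d z y).

Definition regular_ultrametric d := regular_metric d /\ ultrametric d.

End regular_metrics.

Definition cantor_set (R : realType) (C : topologicalType) :=
  [/\ compact [set: C],
      exists d : C -> C -> R, regular_metric d,
      totally_disconnected [set: C] &
      perfect_set [set: C]].

Section michon_tree.
Context {R : realType} {C : topologicalType} (d : C -> C -> R).

Definition vertices : set (set C) :=
  [set A | exists x (e : R), 0 < e /\ A = dball d x e].

Definition vertex : Type := set_type vertices.
HB.instance Definition _ := Choice.on vertex.

Definition shadow (v : vertex) : set C := \val v.

Definition diam (v : vertex) : R :=
  sup [set r | exists x y, [/\ shadow v x, shadow v y & r = d x y]].

Definition child (v w : vertex) : Prop :=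
  shadow w `<` shadow v /\
  forall u : vertex, shadow u `<` shadow v ->
    shadow w `<=` shadow u -> u = w.

Definition child_pairs (v : vertex) : set (vertex * vertex) :=
  [set p | [/\ child v p.1, child v p.2 & p.1 <> p.2]].

Definition choices_at (v : vertex) : set (C * C) :=
  [set p | [/\ shadow v p.1, shadow v p.2 & d p.1 p.2 = diam v]].

Definition choice_functions : set (vertex -> C * C) :=
  [set tau | forall v, choices_at v (tau v)].

Definition choice_fun : Type := set_type choice_functions.
HB.instance Definition _ := Choice.on choice_fun.

Definition choice_eval (tau : choice_fun) : vertex -> C * C := \val tau.

Definition lipschitz_fun (f : C -> R[i]) :=
  exists k : R, forall x y, `|f x - f y| <= (k * d x y)%:C.

Definition step_space : set (C -> R) :=
  [set f | exists (n : nat) (c : 'I_n -> R) (v : 'I_n -> vertex),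
     f = fun x => \sum_(i < n) c i * \1_(shadow (v i)) x].

End michon_tree.
Coercion choice_eval : choice_fun >-> Funclass.

(* Unconditional sums, meaningful for absolutely summable families. *)
Section unconditional_sums.
Context {R : realType} {I : choiceType}.

Definition rsum (F : I -> R) : R :=
  fine (\esum_(i in [set: I]) (Num.max (F i) 0)%:E)
  - fine (\esum_(i in [set: I]) (Num.max (- F i) 0)%:E).

Definition csum (F : I -> R[i]) : R[i] :=
  rsum (fun i => complex.Re (F i)) +i* rsum (fun i => complex.Im (F i)).

End unconditional_sums.

(* The Hilbert space l^2(V) (x) C^2 is the set of square-summable families     *)
(* psi : V -> C^2.  The operators below may be unbounded; they are given by    *)
(* formulas that make sense on every family, and are only ever evaluated on    *)
(* the images of the canonical orthonormal basis (v, j) |-> delta_v (x) e_j.   *)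
Section spectral_triple.
Context {R : realType} {C : topologicalType} (d : C -> C -> R).
Local Notation V := (vertex d).

Definition spinor : Type := V -> 'cV[R[i]]_2.
Definition operator : Type := spinor -> spinor.

Definition inner (psi phi : spinor) : R[i] :=
  csum (fun i : V * 'I_2 => (psi i.1 i.2 0)^* * phi i.1 i.2 0).

Definition hbasis (i : V * 'I_2) : spinor :=
  fun v => if v == i.1 then delta_mx i.2 0 else 0.

Definition mx_entry (A : operator) (i j : V * 'I_2) : R[i] :=
  inner (hbasis i) (A (hbasis j)).

(* Absolute summability of all matrix entries.  It implies trace class, and is *)
(* equivalent to it for operators that, as all those considered here, preserve *)
(* each fibre delta_v (x) C^2.                                                 *)
Definition trace_summable (A : operator) : Prop :=
  (\esum_(p in [set: (V * 'I_2) * (V * 'I_2)])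
     (ComplexField.Normc.normc (mx_entry A p.1 p.2))%:E < +oo)%E.

Definition trace (A : operator) : R[i] := csum (fun i => mx_entry A i i).

(* <delta_v (x) e_j, A^* psi> = <A (delta_v (x) e_j), psi> *)
Definition adjoint (A : operator) : operator :=
  fun psi v => \col_j inner (A (hbasis (v, j))) psi.

Definition commutator (A B : operator) : operator :=
  fun psi v => A (B psi) v - B (A psi) v.

Definition sigma1 : 'M[R[i]]_2 := \matrix_(i, j) (i != j)%:R.

Definition dirac_op : operator :=
  fun psi v => ((diam v)^-1)%:C *: (sigma1 *m psi v).

(* [abs_dirac_powN s] is |D|^{-s}, where (|D| psi)(v) = (diam v)^-1 psi(v) by  *)
(* [abs_dirac_sqr] below.                                                      *)
Definition abs_dirac_powN (s : R) : operator :=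
  fun psi v => (diam v `^ s)%:C *: psi v.

Lemma abs_dirac_sqr (psi : spinor) : (forall v : V, 0 < diam v) ->
  abs_dirac_powN (- 1) (abs_dirac_powN (- 1) psi) = dirac_op (dirac_op psi).
Proof.
move=> diam_gt0; apply/funext => v; rewrite /abs_dirac_powN /dirac_op.
rewrite powR_inv1 ?ltW// -scalemxAr mulmxA.
suff -> : sigma1 *m sigma1 = 1%:M by rewrite mul1mx.
apply/matrixP => i j; rewrite !mxE !big_ord_recl big_ord0 !mxE addr0.
by case: i => [[|[|?]] ?] //; case: j => [[|[|?]] ?] //=;
  rewrite ?(mulr0, mulr1, mul0r, addr0, add0r).
Qed.

Definition repr_op (tau : choice_fun d) (f : C -> R[i]) : operator :=
  fun psi v =>
    diag_mx (\row_j (if j == 0 then f (tau v).1 else f (tau v).2)) *m psi v.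

Definition zeta_trace (s : R) : R[i] := trace (abs_dirac_powN s).

Definition abscissa : \bar R :=
  ereal_inf [set s%:E | s in [set s : R | trace_summable (abs_dirac_powN s)]].

Definition zeta_ratio (tau : choice_fun d) (f : C -> R[i]) (s : R) : R[i] :=
  trace (abs_dirac_powN s \o repr_op tau f) / zeta_trace s.

Definition zeta_regular : Prop :=
  exists s0 : R,
    [/\ abscissa = s0%:E,
        exists2 L : R, 0 < L &
          ((s - s0)%:C * zeta_trace s : R[i]^o) @[s --> s0^'+]
            --> (L%:C : R[i]^o) &
        forall (f : C -> R[i]) (tau : choice_fun d), lipschitz_fun d f ->
          exists l : R[i],
            (zeta_ratio tau f s : R[i]^o) @[s --> s0^'+] --> (l : R[i]^o)].

Definition form_op (s : R) (tau : choice_fun d) (f g : C -> R[i]) : operator :=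
  abs_dirac_powN s \o adjoint (commutator dirac_op (repr_op tau f))
                   \o commutator dirac_op (repr_op tau g).

End spectral_triple.

Definition borel (C : ptopologicalType) := g_sigma_algebraType (@open C).

Definition cintegral {dd : measure_display} {T : measurableType dd}
    {R : realType} (mu : {measure set T -> \bar R}) (F : T -> R[i]) : R[i] :=
  (\int[mu]_x complex.Re (F x)) +i* (\int[mu]_x complex.Im (F x)).

Definition cintegrable {dd : measure_display} {T : measurableType dd}
    {R : realType} (mu : {measure set T -> \bar R}) (F : T -> R[i]) : Prop :=
  mu.-integrable [set: T] (EFin \o (fun x => complex.Re (F x))) /\
  mu.-integrable [set: T] (EFin \o (fun x => complex.Im (F x))).

Section zeta_measure.
Context {R : realType} {C : ptopologicalType} (d : C -> C -> R).
Variable mu : probability (borel C) R.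

Definition zeta_measure : Prop :=
  forall s0 : R, abscissa d = s0%:E ->
  forall (f : C -> R[i]) (tau : choice_fun d), lipschitz_fun d f ->
    (zeta_ratio tau f s : R[i]^o) @[s --> s0^'+]
      --> (cintegral mu (f : borel C -> R[i]) : R[i]^o).

Definition nu_mass (v : vertex d) : \bar R :=
  (\esum_(p in child_pairs v) (mu (shadow p.1) * mu (shadow p.2)))%E.

Definition nu_at (v : vertex d) (B : set (borel C * borel C)) : \bar R :=
  ((mu \x mu) (B `&` choices_at v) / nu_mass v)%E.

End zeta_measure.

Section choices_nonempty.
Context {R : realType} {C : ptopologicalType} {d : C -> C -> R}.
Hypotheses (hC : cantor_set R C) (hd : regular_ultrametric d).

Lemma choices_at_nonempty (v : vertex d) : choices_at v !=set0.
Proof.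
have [cptC _ _ _] := hC.
have [[[d0 dC dtri] dtop] dultra] := hd.
have dxx x : d x x = 0 by apply/d0.
have [x [e [e0 vE]]] := set_mem (valP v).
have sE : shadow v = dball d x e by [].
have closed_v : closed (shadow v).
  rewrite -[shadow v]setCK; apply: open_closedC.
  rewrite openE => y yv; apply/dtop; exists e => // z yz zv.
  apply: yv; rewrite sE /dball /=; apply: le_lt_trans (dultra x y z) _.
  by rewrite gt_max; apply/andP; split; [move: zv; rewrite sE | rewrite dC].
have cpt_v : compact (shadow v) by exact: subclosed_compact closed_v cptC _.
have cont_dx : continuous (d x : C -> R).
  move=> y; apply/cvgrPdist_lt => r r0.
  have : nbhs y (dball d y r) by apply/dtop; exists r.
  apply: filterS => z yz.
  rewrite ltr_norml; apply/andP; split.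
    by have := dtri x z y; move: yz; rewrite /dball /=; lra.
  by have := dtri x y z; move: yz; rewrite (dC z y) /dball /=; lra.
have vx : shadow v x by rewrite sE /dball /= dxx.
have [c /set_mem vc cmax] : exists2 c : C, c \in shadow v &
    forall t : C, t \in shadow v -> d x t <= d x c.
  by apply: compact_EVT_max => //; [exists x | exact: continuous_subspaceT].
exists (x, c); split => //=; apply/eqP; rewrite eq_le; apply/andP; split.
  apply: ub_le_sup; last by exists x, c.
  exists (d x c) => _ [y [z [vy vz ->]]].
  apply: le_trans (dultra y z x) _; rewrite ge_max dC.
  by rewrite !cmax //; exact: mem_set.
apply: ge_sup; first by exists (d x c), x, c.
move=> _ [y [z [vy vz ->]]].
apply: le_trans (dultra y z x) _; rewrite ge_max dC.
by rewrite !cmax //; exact: mem_set.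
Qed.

Definition default_choice : choice_fun d :=
  SigSub (mem_set (projT2 (choice choices_at_nonempty))).

End choices_nonempty.

(* The space of choices.  The (proof) parameters serve to equip it with a      *)
(* default element, as required of measurable types.                           *)
Section space_of_choices.
Context {R : realType} {C : ptopologicalType} {d : C -> C -> R}.
Variables (hC : cantor_set R C) (hd : regular_ultrametric d).

Definition Upsilon : Type :=
  let _ := hC in let _ := hd in choice_fun d.
HB.instance Definition _ := Choice.on Upsilon.
HB.instance Definition _ := isPointed.Build Upsilon
  (default_choice hC hd).

Definition Upsilon_cylinders : set (set Upsilon) :=
  [set X | exists (v : vertex d) (B : set (borel C * borel C)),
     measurable B /\ X = [set tau : choice_fun d | B (tau v)]].

Definition UpsilonM := g_sigma_algebraType Upsilon_cylinders.

Definition is_nu (mu : probability (borel C) R) (nu : probability UpsilonM R) :=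
  forall (r : seq (vertex d)) (B : vertex d -> set (borel C * borel C)),
    uniq r -> (forall v, measurable (B v)) ->
    nu [set tau : choice_fun d | forall v, v \in r -> B v (tau v)]
    = (\prod_(v <- r) nu_at mu v (B v))%E.

End space_of_choices.

(* Closable Dirichlet form on the real Hilbert space L^2(mu).  Elements of L^2 *)
(* are represented by square-integrable functions, so that the form must in    *)
(* addition be compatible with equality almost everywhere.                     *)
Record closable_dirichlet_form {dd : measure_display} {T : measurableType dd}
    {R : realType} (mu : {measure set T -> \bar R})
    (Dom : set (T -> R)) (Q : (T -> R) -> (T -> R) -> R) : Prop := {
  form_dom_L2 : forall f, Dom f -> f \in Lfun mu 2%:E;
  form_dom_zero : Dom (fun=> 0);
  form_dom_linear : forall (a : R) f g, Dom f -> Dom g ->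
    Dom (fun x => a * f x + g x);
  form_dom_dense : forall f, f \in Lfun mu 2%:E ->
    forall e : R, 0 < e -> exists2 g, Dom g &
      ('N[mu]_2%:E[EFin \o (fun x => f x - g x)%R] < e%:E)%E;
  form_ae : forall f f' g, Dom f -> Dom f' -> Dom g ->
    {ae mu, forall x, f x = f' x} -> Q f g = Q f' g;
  form_sym : forall f g, Dom f -> Dom g -> Q f g = Q g f;
  form_linear : forall (a : R) f f' g, Dom f -> Dom f' -> Dom g ->
    Q (fun x => a * f x + f' x) g = a * Q f g + Q f' g;
  form_ge0 : forall f, Dom f -> 0 <= Q f f;
  form_closable : forall f_ : nat -> (T -> R), (forall n, Dom (f_ n)) ->
    ('N[mu]_2%:E[EFin \o f_ n] @[n --> \oo] --> 0)%E ->
    Q (fun x => f_ p.1 x - f_ p.2 x) (fun x => f_ p.1 x - f_ p.2 x)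
      @[p --> (\oo, \oo)] --> 0 ->
    Q (f_ n) (f_ n) @[n --> \oo] --> 0;
  form_markov : forall f, Dom f ->
    let ft := fun x => Num.min (Num.max 0 (f x)) 1 in
    Dom ft /\ Q ft ft <= Q f f
}.

(* Main.v *)
Require Import Defs.
From HB Require Import structures.
From mathcomp Require Import all_boot all_order all_algebra.
From mathcomp Require Import all_classical all_reals all_analysis.
From mathcomp Require Import finmap.
From mathcomp Require Import measurable_realfun measurable_fun_approximation.
From mathcomp Require Import complex ring lra zify.
Set Implicit Arguments.
Unset Strict Implicit.
Unset Printing Implicit Defensive.
Import Order.TTheory GRing.Theory Num.Theory.
Import numFieldNormedType.Exports.
Local Open Scope classical_set_scope.
Local Open Scope ring_scope.
Local Open Scope complex_scope.

(** For a real function [f], the commutator of the Dirac operator with the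
    representation is fibrewise: over the vertex [v] it is the off-diagonal
    matrix with entries [+/- (f (tau v).1 - f (tau v).2) / diam v].  Half the
    trace in the statement is therefore the sum over the vertices of

      diam v ^ (s - 2) * (jump of f at tau v) * (jump of g at tau v).

    A step function is constant on all balls of some radius [e > 0]
    ([step_spaceP]), and by compactness only finitely many vertices have
    diameter at least [e] ([finite_large_vertices]); the sum is thus finite,
    and integrating it over the choices turns the form into a finite sum of
    integrals over the spaces of choices at single vertices ([exists_levels]).

    The measure on the space of choices is a countable product.  It is obtained
    from a product of a sequence of arbitrary probability measures
    ([sequence_product]), itself the Caratheodory extension of an additive
    function on the sets that depend on finitely many coordinates.  The point
    is countable subadditivity: if the inequality failed for a cover, then
    it would still fail after freezing the first coordinate at a suitable
    value, then the second one, and so on; the sequence of frozen values lies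
    in the covered set but in no set of the cover
    ([cond_prob_sigma_subadditive]).  At a vertex, [choices_atE] identifies the
    admissible pairs with the pairs of points in distinct children, so that
    the normalizing constant is the total mass ([nu_massE]).

    Each property of the form is then checked vertex by vertex.  Truncation
    shrinks every jump, hence the Markov property.  The marginals of the
    measure at [v] are dominated by a multiple of [mu], so that the
    contribution of finitely many vertices is bounded by a multiple of the
    squared norm in [L^2] ([level_form_bound]); the form is thus a supremum of
    continuous quadratic forms, which gives lower semicontinuity and
    closability ([energy_closable]).  The normalizing constants being nonzero,
    every vertex has positive mass ([shadow_mass_gt0]), and step functions
    that agree almost everywhere are equal.  Density follows from a Dynkin
    argument: an open set is the increasing union of the sets of points whose
    ball of radius [1 / (n + 1)] it contains, and those have locally
    constant indicators. *)

(** * Products of a sequence of probability measures *)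

Section sequence_space.
Context {dd : measure_display} {X : measurableType dd}.

Definition coordinate_sets : set (set (nat -> X)) :=
  [set A | exists (n : nat) (B : set X),
     measurable B /\ A = [set w | B (w n)]].

Definition sequence_space := g_sigma_algebraType coordinate_sets.

Definition update (w : nat -> X) (n : nat) (y : X) : nat -> X :=
  fun k => if k == n then y else w k.

Definition depends_below (n : nat) (A : set (nat -> X)) :=
  forall w w', (forall k, (k < n)%N -> w k = w' k) -> A w -> A w'.

Definition finitary (A : set (nat -> X)) :=
  measurable (A : set sequence_space) /\ exists n, depends_below n A.

Lemma measurable_coordinate n :
  measurable_fun [set: sequence_space] (fun w : sequence_space => w n).
Proof.
move=> _ B mB; rewrite setTI; apply: sub_sigma_algebra.
by exists n, B.
Qed.

Lemma measurable_update n : measurable_fun setT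
  (fun p : sequence_space * X => update p.1 n p.2 : sequence_space).
Proof.
apply: (@measurability _ _ _ sequence_space setT _ coordinate_sets) => //.
move=> _ [_ [k [B [mB ->]]] <-]; rewrite setTI.
have [->|kn] := eqVneq k n.
  rewrite (_ : _ @^-1` _ = snd @^-1` B); last first.
    by apply/seteqP; split=> p; rewrite /= /update eqxx.
  by rewrite -[X in measurable X]setTI; exact: measurable_snd.
rewrite (_ : _ @^-1` _ = fst @^-1` [set w : sequence_space | B (w k)]); last first.
  by apply/seteqP; split=> p; rewrite /= /update (negbTE kn).
rewrite -[X in measurable X]setTI; apply: measurable_fst => //.
by apply: sub_sigma_algebra; exists k, B.
Qed.

Lemma depends_below_le m n A :
  (m <= n)%N -> depends_below m A -> depends_below n A.
Proof.
by move=> mn Am w w' ww'; apply: Am => k km; apply: ww'; exact: leq_trans km mn.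
Qed.

Lemma depends_below_indic {R : realType} n A w w' : depends_below n A ->
  (forall k, (k < n)%N -> w k = w' k) -> \1_A w = \1_A w' :> R.
Proof.
move=> An ww'; rewrite !indicE; congr (_%:R); congr nat_of_bool.
by apply/idP/idP => /set_mem H; apply/mem_set; apply: An H => k kn;
  rewrite ww'.
Qed.

Lemma depends_below_update {R : realType} n m A w y : depends_below n A ->
  (n <= m)%N -> \1_A (update w m y) = \1_A w :> R.
Proof.
move=> An nm; apply: (depends_below_indic An) => k kn.
by rewrite /update; case: eqP => // km; move: kn; rewrite km ltnNge nm.
Qed.

Lemma finitary0 : finitary set0.
Proof. by split; [exact: measurable0 | exists 0%N]. Qed.

Lemma finitaryU : setU_closed finitary.
Proof.
move=> A B [mA [m Am]] [mB [n Bn]]; split; first exact: measurableU.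
exists (maxn m n) => w w' ww' [Aw|Bw]; [left|right].
  by apply: depends_below_le Am _ _ ww' Aw; exact: leq_maxl.
by apply: depends_below_le Bn _ _ ww' Bw; exact: leq_maxr.
Qed.

Lemma finitaryC : setC_closed finitary.
Proof.
move=> A [mA [m Am]]; split; first exact: measurableC.
by exists m => w w' ww' nAw Aw'; apply: nAw; apply: Am Aw' => k km; rewrite ww'.
Qed.

(** A copy of the space of sequences that carries the algebra of finitary sets;
    [sequence_space] carries the generated sigma-algebra. *)
Definition finitary_algebra : Type := nat -> X.

HB.instance Definition _ := Pointed.on finitary_algebra.
HB.instance Definition _ := @isAlgebraOfSets.Build default_measure_display
  finitary_algebra finitary finitary0 finitaryU finitaryC.

End sequence_space.
Arguments sequence_space {dd} X.
Arguments finitary_algebra {dd} X.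

Section product_of_sequence.
Context {dd : measure_display} {X : measurableType dd} {R : realType}.
Context (P : nat -> probability X R).
Implicit Types (A : set (nat -> X)) (w : nat -> X).
Local Open Scope ereal_scope.

(** Integration over the coordinates [k], ..., [k + j - 1], the last one
    innermost; the other coordinates are read in the argument. *)
Fixpoint average (k j : nat) (f : (nat -> X) -> \bar R) : (nat -> X) -> \bar R :=
  if j is j'.+1
  then fun w => \int[P k]_y average k.+1 j' f (update w k y) else f.

Lemma average_ge0 k j f : (forall w, 0 <= f w) -> forall w, 0 <= average k j f w.
Proof.
move=> f0; elim: j k => [|j IH] k w //=.
by apply: integral_ge0 => y _; exact: IH.
Qed.

Lemma measurable_update_at w n :
  measurable_fun setT (fun y => update w n y : sequence_space X).
Proof.
exact: (@measurableT_comp _ _ _ _ _ _ _ _ (pair (w : sequence_space X))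
  (measurable_update n) (pair1_measurable _)).
Qed.

Lemma measurable_average k j (f : sequence_space X -> \bar R) :
  (forall w, 0 <= f w) -> measurable_fun [set: sequence_space X] f ->
  measurable_fun [set: sequence_space X] (average k j f : sequence_space X -> \bar R).
Proof.
move=> f0 mf; elim: j k => [|j IH] k //=.
apply: (@measurable_fun_fubini_tonelli_F _ _ _ _ _ (P k)
  (fun p : sequence_space X * X => average k.+1 j f (update p.1 k p.2))).
  by apply: measurableT_comp (IH k.+1) (measurable_update k).
by move=> p; exact: average_ge0.
Qed.

Lemma averageD k j i f w :
  average k (j + i) f w = average k j (average (k + j) i f) w.
Proof.
elim: j k w => [|j IH] k w; first by rewrite addn0.
by rewrite addSn /=; apply: eq_integral => y _; rewrite IH addSnnS.
Qed.

Lemma eq_average k j f g w : (forall w, f w = g w) ->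
  average k j f w = average k j g w.
Proof.
move=> fg; elim: j k w => [|j IH] k w //=.
by apply: eq_integral => y _; exact: IH.
Qed.

(** Averaging over coordinates that the event does not see changes nothing,
    because each [P k] has mass one. *)
Lemma average_depends_below n A k j w : depends_below n A -> (n <= k)%N ->
  average k j (EFin \o \1_A) w = (\1_A w)%:E.
Proof.
move=> An; elim: j k w => [|j IH] k w nk //=.
rewrite (eq_integral (cst (\1_A w)%:E)); last first.
  by move=> y _; rewrite IH 1?ltnW// (depends_below_update _ _ An).
by rewrite integral_cst//= probability_setT mule1.
Qed.

(** The probability of [A] given the first [k] coordinates of [w].  Averaging
    over the coordinates from [k] up to any [n] below which [A] is decided gives
    the same value, by [cond_probE]. *)
Definition cond_prob (k : nat) (w : nat -> X) A : \bar R :=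
  let n := xget 0%N [set n | depends_below n A] in
  average k (n - k) (EFin \o \1_A) w.

Lemma cond_probE n k w A : depends_below n A ->
  cond_prob k w A = average k (n - k) (EFin \o \1_A) w.
Proof.
move=> An; rewrite /cond_prob; set m := xget _ _.
have Am : depends_below m A.
  exact: (xgetPex 0%N (ex_intro (fun k => depends_below k A) n An)).
suff H m' n' : depends_below m' A -> (m' <= n')%N ->
    average k (m' - k) (EFin \o \1_A) w = average k (n' - k) (EFin \o \1_A) w.
  by case: (leqP m n) => mn; [exact: H | apply/esym/H => //; exact: ltnW].
move=> Am' mn; have -> : (n' - k = (m' - k) + (n' - maxn m' k))%N by lia.
rewrite averageD; apply: eq_average => w'.
by apply/esym/(average_depends_below _ _ Am'); rewrite -leq_subLR.
Qed.

Lemma cond_prob_late n k w A : depends_below n A -> (n <= k)%N ->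
  cond_prob k w A = (\1_A w)%:E.
Proof.
by move=> An nk; rewrite (cond_probE _ _ An); move: nk => /eqP ->.
Qed.

Lemma cond_prob_step k w A : finitary A ->
  cond_prob k w A = \int[P k]_y cond_prob k.+1 (update w k y) A.
Proof.
move=> [_ [n An]].
have An' : depends_below (maxn n k.+1) A.
  by apply: depends_below_le An; exact: leq_maxl.
rewrite (cond_probE _ _ An').
have -> : (maxn n k.+1 - k = (maxn n k.+1 - k.+1).+1)%N by lia.
by apply: eq_integral => y _; rewrite (cond_probE _ _ An').
Qed.

Lemma cond_prob_ge0 k w A : 0 <= cond_prob k w A.
Proof. by apply: average_ge0 => w'; rewrite lee_fin. Qed.

Lemma measurable_EFin_indic A : finitary A ->
  measurable_fun [set: sequence_space X] (EFin \o \1_A : _ -> \bar R).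
Proof. by move=> [mA _]; apply/measurable_EFinP; exact: measurable_indic. Qed.

Lemma measurable_cond_prob k A : finitary A ->
  measurable_fun [set: sequence_space X] (cond_prob k ^~ A).
Proof.
move=> fA; apply: measurable_average; last exact: measurable_EFin_indic.
by move=> w; rewrite lee_fin.
Qed.

Lemma average_add k j (f g : sequence_space X -> \bar R) w :
  (forall w, 0 <= f w) -> (forall w, 0 <= g w) ->
  measurable_fun [set: sequence_space X] f ->
  measurable_fun [set: sequence_space X] g ->
  average k j (f \+ g) w = average k j f w + average k j g w.
Proof.
move=> f0 g0 mf mg; elim: j k w => [|j IH] k w //=.
rewrite (eq_integral _ _ (fun y _ => IH k.+1 (update w k y))).
rewrite ge0_integralD//.
- by move=> y _; exact: average_ge0.
- exact: measurableT_comp (measurable_average _ _ f0 mf)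
                          (measurable_update_at _ _).
- by move=> y _; exact: average_ge0.
- exact: measurableT_comp (measurable_average _ _ g0 mg)
                          (measurable_update_at _ _).
Qed.

Lemma cond_probU k w A B : finitary A -> finitary B -> A `&` B = set0 ->
  cond_prob k w (A `|` B) = cond_prob k w A + cond_prob k w B.
Proof.
move=> fA fB AB; have [mA [m Am]] := fA; have [mB [n Bn]] := fB.
have Am' := depends_below_le (leq_maxl m n) Am.
have Bn' := depends_below_le (leq_maxr m n) Bn.
have ABn : depends_below (maxn m n) (A `|` B).
  by move=> v v' vv' [Av|Bv]; [left; apply: Am' Av|right; apply: Bn' Bv].
rewrite (cond_probE _ _ Am') (cond_probE _ _ Bn') (cond_probE _ _ ABn).
rewrite -average_add; [|by move=> v; rewrite lee_fin..|
  exact: measurable_EFin_indic|exact: measurable_EFin_indic].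
apply: eq_average => v /=; rewrite -EFinD; congr EFin.
have : ~~ ((v \in A) && (v \in B)).
  by apply/negP => /andP[/set_mem Av /set_mem Bv]; have : (A `&` B) v by []; rewrite AB.
by rewrite !indicE in_setU; case: (v \in A); case: (v \in B) => //= _;
  rewrite ?addr0 ?add0r.
Qed.

Lemma cond_prob0 k w : cond_prob k w set0 = 0.
Proof.
have h : depends_below 0 (set0 : set (nat -> X)) by [].
by rewrite (cond_prob_late _ h)// indic0.
Qed.

(** If every value of the coordinate [k] satisfied the subadditivity inequality,
    then integrating over that coordinate would give the inequality one step
    earlier. *)
Lemma cond_prob_escape k w A (F : (set (nat -> X))^nat) :
  finitary A -> (forall j, finitary (F j)) ->
  \sum_(j <oo) cond_prob k w (F j) < cond_prob k w A ->
  exists y, \sum_(j <oo) cond_prob k.+1 (update w k y) (F j)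
    < cond_prob k.+1 (update w k y) A.
Proof.
move=> fA fF; apply: contraPP => /forallNP noy; apply/negP; rewrite -leNgt.
have mc B : finitary B ->
    measurable_fun setT (fun y => cond_prob k.+1 (update w k y) B).
  move=> fB.
  exact: measurableT_comp (measurable_cond_prob _ fB) (measurable_update_at _ _).
rewrite (cond_prob_step _ _ fA).
rewrite (eq_eseriesr (fun j _ => cond_prob_step k w (fF j))).
rewrite -integral_nneseries//; last 2 first.
- by move=> j; exact: mc.
- by move=> j y _; exact: cond_prob_ge0.
apply: ge0_le_integral => //.
- by move=> y _; exact: cond_prob_ge0.
- exact: mc.
- by apply: ge0_emeasurable_sum => [j y _ _|j _]; [exact: cond_prob_ge0|exact: mc].
- by move=> y _; rewrite leNgt; apply/negP; exact: noy.
Qed.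

Definition start : nat -> X := fun=> point.

(** A strict failure of subadditivity propagates along a sequence [w] of
    successively chosen coordinates.  Once all the coordinates that decide [A]
    are chosen, the conditional probability of [A] is 0 or 1, so the failure puts
    [w] in [A].  Then [w] is in some [F j], and once the coordinates that decide
    [F j] are chosen too, the sum is at least 1: a contradiction. *)
Lemma cond_prob_sigma_subadditive A (F : (set (nat -> X))^nat) :
  finitary A -> (forall j, finitary (F j)) -> A `<=` \bigcup_j F j ->
  cond_prob 0 start A <= \sum_(j <oo) cond_prob 0 start (F j).
Proof.
move=> fA fF AF; rewrite leNgt; apply/negP => lt0.
pose bad k w := \sum_(j <oo) cond_prob k w (F j) < cond_prob k w A.
have /choice[y yP] (p : nat * (nat -> X)) :
    exists y, bad p.1 p.2 -> bad p.1.+1 (update p.2 p.1 y).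
  have [b|nb] := pselect (bad p.1 p.2); last by exists point.
  by have [y yP] := cond_prob_escape fA fF b; exists y.
(* [w_ k] has its coordinates below [k] already chosen. *)
pose w_ := fix w_ k := if k is k'.+1 then update (w_ k') k' (y (k', w_ k'))
                       else start.
have bad_w k : bad k (w_ k).
  by elim: k => [|k IH] //=; exact: (yP (k, w_ k)).
pose w k := y (k, w_ k).
have w_E n k : (k < n)%N -> w_ n k = w k.
  elim: n => // n IH; rewrite ltnS leq_eqVlt /= /update => /orP[/eqP ->|kn].
    by rewrite eqxx.
  by rewrite (ltn_eqF kn); exact: IH.
have Aw : A w.
  have [_ [n An]] := fA; apply: (An _ _ (w_E n)); apply: contrapT => nA.
  have := bad_w n; rewrite /bad (cond_prob_late _ An)// indicE memNset//.
  rewrite ltNge => /negP; apply; apply: nneseries_ge0 => j _ _.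
  exact: cond_prob_ge0.
have [j _ Fjw] := AF _ Aw.
have [[_ [n An]] [_ [m Fm]]] := (fA, fF j).
have := bad_w (maxn n m).
rewrite /bad (cond_prob_late _ An) ?leq_maxl// ltNge => /negP; apply.
apply: (@le_trans _ _ (cond_prob (maxn n m) (w_ (maxn n m)) (F j))).
  rewrite (cond_prob_late _ Fm) ?leq_maxr// lee_fin.
  have -> : \1_(F j) (w_ (maxn n m)) = 1%R :> R.
    rewrite indicE mem_set//; apply: Fm Fjw => k km; apply/esym/w_E.
    by rewrite (leq_trans km)// leq_maxr.
  by rewrite indicE; case: (_ \in _).
rewrite (@nneseriesD1 _ _ j)//; last by move=> *; exact: cond_prob_ge0.
rewrite leeDl//; apply: nneseries_ge0 => *; exact: cond_prob_ge0.
Qed.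

Definition finitary_prob (A : set (finitary_algebra X)) : \bar R :=
  cond_prob 0 start A.

Lemma finitary_prob_semi_additive :
  measure_function.semi_additive finitary_prob.
Proof.
by apply/(additive2P (cond_prob0 _ _)) => A B mA mB; exact: cond_probU.
Qed.

HB.instance Definition _ := isContent.Build _ _ _ finitary_prob
  (cond_prob_ge0 0 start) finitary_prob_semi_additive.

Lemma finitary_prob_sigma_subadditive :
  measurable_subset_sigma_subadditive finitary_prob.
Proof. by move=> A F fF fA; exact: cond_prob_sigma_subadditive. Qed.

HB.instance Definition _ := Content_SigmaSubAdditive_isMeasure.Build _ _ _
  finitary_prob finitary_prob_sigma_subadditive.

Lemma measurable_sequence_space :
  @measurable _ (sequence_space X) = <<s @measurable _ (finitary_algebra X) >>.
Proof.
apply/seteqP; split.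
  apply: sub_smallest2r; first exact: smallest_sigma_algebra.
  move=> _ [n [B [mB ->]]]; split.
    by apply: sub_sigma_algebra; exists n, B.
  by exists n.+1 => w w' ww' /=; rewrite ww'.
apply: smallest_sub; first exact: (@sigma_algebra_measurable _ (sequence_space X)).
by move=> A [mA _].
Qed.

Definition box (s : seq nat) (B : nat -> set X) : set (nat -> X) :=
  [set w | forall k, k \in s -> B k (w k)].

Lemma finitary_box s B : (forall k, measurable (B k)) -> finitary (box s B).
Proof.
move=> mB; split; last first.
  exists (\max_(k <- s) k).+1 => w w' ww' wB k ks.
  rewrite -ww'; first exact: wB.
  by rewrite ltnS; exact: (@leq_bigmax_seq _ s predT id).
elim: s => [|n s IH].
  have -> : box [::] B = setT by rewrite -subTset.
  exact: (@measurableT _ (sequence_space X)).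
rewrite (_ : box _ _ = [set w | B n (w n)] `&` box s B).
  by apply: measurableI => //; apply: sub_sigma_algebra; exists n, (B n).
apply/seteqP; split => w /=.
  by move=> wB; split=> [|k ks]; apply: wB; rewrite inE ?eqxx ?ks ?orbT.
by move=> [wn ws] k; rewrite inE => /predU1P[->//|]; exact: ws.
Qed.

Lemma indic_box_update (B : nat -> set X) k w y :
  \1_(box (iota 0 k.+1) B) (update w k y) =
  (\1_(box (iota 0 k) B) w * \1_(B k) y)%R :> R.
Proof.
rewrite !indicE -natrM mulnb; congr (nat_of_bool _)%:R; apply/idP/andP.
  move=> /set_mem wB; split; apply/mem_set.
    move=> i ik; have := wB i; rewrite /update.
    move: ik; rewrite !mem_iota !add0n => /= ik; rewrite (ltn_eqF ik).
    by apply; rewrite ltnS ltnW.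
  have := wB k; rewrite /update eqxx; apply.
  by rewrite mem_iota add0n /= ltnSn.
move=> [/set_mem wB /set_mem yB]; apply/mem_set => i.
rewrite mem_iota add0n ltnS /= leq_eqVlt /update => /orP[/eqP ->|ik].
  by rewrite eqxx.
by rewrite (ltn_eqF ik); apply: wB; rewrite mem_iota.
Qed.

(** Fubini for boxes, peeling off the coordinate [k] first. *)
Lemma cond_prob_box (B : nat -> set X) j k w : (forall i, measurable (B i)) ->
  cond_prob k w (box (iota 0 (k + j)) B) =
  (\1_(box (iota 0 k) B) w)%:E * \prod_(k <= i < k + j) P i (B i).
Proof.
move=> mB; elim: j k w => [|j IH] k w.
  have Bk : depends_below k (box (iota 0 k) B).
    move=> v v' vv' vB i i_k; rewrite -vv'; first exact: vB.
    by move: i_k; rewrite mem_iota.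
  by rewrite addn0 big_geq// mule1 (cond_prob_late _ Bk).
rewrite cond_prob_step; last exact: finitary_box.
under eq_integral do rewrite addnS -addSn IH indic_box_update EFinM muleAC.
rewrite ge0_integralZl//.
- rewrite integral_indic// setIT addSnnS [in RHS]big_ltn ?muleA; last by lia.
  by rewrite muleAC.
- by apply/measurable_EFinP; exact: measurable_indic.
- by apply: mule_ge0; [rewrite lee_fin|apply: prode_ge0 => i _].
Qed.

Definition product_prob : set (sequence_space X) -> \bar R :=
  measure_extension finitary_prob.

Lemma product_prob_box s (B : nat -> set X) : uniq s ->
  (forall k, measurable (B k)) ->
  product_prob (box s B) = \prod_(k <- s) P k (B k).
Proof.
move=> us mB; pose B' k := if k \in s then B k else setT.
have mB' k : measurable (B' k) by rewrite /B'; case: ifP.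
have [n s_n] : exists n, forall k, k \in s -> (k < n)%N.
  exists (\max_(k <- s) k).+1 => k ks.
  by rewrite ltnS; exact: (@leq_bigmax_seq _ s predT id).
have sB : box s B = box (iota 0 n) B'.
  apply/seteqP; split => w wB k.
    by move=> _; rewrite /B'; case: ifPn => // ks; exact: wB.
  move=> ks; have := wB k; rewrite /B' ks; apply.
  by rewrite mem_iota add0n /=; exact: s_n.
rewrite /product_prob /measure_extension measurable_mu_extE; last first.
  exact: finitary_box.
rewrite sB /= /finitary_prob -(add0n n) cond_prob_box// add0n.
rewrite (_ : \1__ _ = 1%R) ?mul1e; last first.
  by rewrite indicE mem_set// => k; rewrite in_nil.
rewrite /B' (eq_bigr (fun k => if k \in s then P k (B k) else 1)); last first.
  by move=> k _; case: ifP => // _; rewrite probability_setT.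
rewrite -big_mkcond/= -big_filter; apply: perm_big; apply: uniq_perm => //.
  by rewrite filter_uniq// iota_uniq.
move=> k; rewrite mem_filter mem_index_iota /=.
by case ks : (k \in s) => //=; exact: s_n.
Qed.

End product_of_sequence.

(** Product of a sequence of probability measures on an arbitrary measurable
    space: no topology is involved. *)
Theorem sequence_product {dd} {X : measurableType dd} {R : realType}
    (P : nat -> probability X R) :
  exists Q : probability (sequence_space X) R,
    forall s B, uniq s -> (forall k, measurable (B k)) ->
      Q (box s B) = (\prod_(k <- s) P k (B k))%E.
Proof.
have mE A : measurable (A : set (sequence_space X)) =
    measurable (A : set (g_sigma_algebraType (@measurable _ (finitary_algebra X)))).
  by rewrite [LHS](congr1 (fun S => S A) measurable_sequence_space).
have Q0 : product_prob P set0 = 0%E by exact: measure0.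
have Qge0 A : (0 <= product_prob P A)%E by exact: measure_ge0.
have Qsigma : semi_sigma_additive (product_prob P).
  move=> F mF tF mUF.
  apply: (@measure_semi_sigma_additive _ _ _
    (measure_extension (finitary_prob P))) => // [i|].
    by rewrite -mE.
  by rewrite -mE.
have QT : product_prob P setT = 1%E.
  have -> : setT = box [::] (fun=> @setT X) by apply/esym; rewrite -subTset.
  by rewrite product_prob_box// big_nil.
pose Qm := isMeasure.Build _ _ _ (product_prob P) Q0 Qge0 Qsigma.
pose Qmeas : {measure set _ -> \bar R} := HB.pack (product_prob P) Qm.
pose Qp := Measure_isProbability.Build _ _ _ Qmeas QT.
pose Q : probability (sequence_space X) R := HB.pack (product_prob P) Qp Qm.
by exists Q => s B us mB; exact: product_prob_box.
Qed.
(** * Geometry of the Michon tree *)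

Section michon_geometry.
Context {R : realType} {C : ptopologicalType} {d : C -> C -> R}.
Context (hC : cantor_set R C) (hd : regular_ultrametric d).
Implicit Types (v w : vertex d) (x y z : C).

Lemma dist_refl x : d x x = 0.
Proof. by have [[[h _ _] _] _] := hd; apply/h. Qed.

Lemma dist_sym x y : d x y = d y x.
Proof. by have [[[_ h _] _] _] := hd. Qed.

Lemma dist_ultra x y z e : d x z < e -> d z y < e -> d x y < e.
Proof.
move=> xz zy; have [_ h] := hd.
by apply: le_lt_trans (h x y z) _; rewrite gt_max xz zy.
Qed.

Lemma dist_ge0 x y : 0 <= d x y.
Proof.
have [[[_ _ h] _] _] := hd.
by have := h x x y; rewrite dist_refl (dist_sym y x); lra.
Qed.

Lemma dball_recenter x y e : d x y < e -> dball d x e = dball d y e.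
Proof.
move=> xy; apply/seteqP; split => z; rewrite /dball /= => h.
  by apply: dist_ultra h; rewrite dist_sym.
exact: dist_ultra h.
Qed.

Lemma dball_center x e : 0 < e -> dball d x e x.
Proof. by rewrite /dball /= dist_refl. Qed.

Lemma open_dball x e : open (dball d x e).
Proof.
have [[_ dtop] _] := hd; rewrite openE => y xy; apply/dtop; exists e.
  exact: le_lt_trans (dist_ge0 _ _) xy.
by rewrite (dball_recenter xy).
Qed.

Lemma exists_finite_net e : 0 < e ->
  exists N : {fset C}, forall x, exists2 c, c \in N & d c x < e.
Proof.
move=> e0; have [cC _ _ _] := hC; move: cC; rewrite compact_cover.
move=> /(_ C setT (fun x => dball d x e)) [].
- by move=> x _; exact: open_dball.
- by move=> x _; exists x => //; exact: dball_center.
by move=> N _ Ncov; exists N => x; have [c /= cN cx] := Ncov x I; exists c.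
Qed.

Lemma finite_dballs e : finite_set (range (fun x => dball d x e)).
Proof.
have [e0|e0] := ltP 0 e; last first.
  apply: (@sub_finite_set _ _ [set set0]); last exact: finite_set1.
  move=> _ [x _ <-] /=; apply/seteqP; split => // y; rewrite /dball /= ltNge.
  by move=> /negP; apply; exact: le_trans e0 (dist_ge0 _ _).
have [N Nnet] := exists_finite_net e0.
apply: sub_finite_set (finite_image (fun x => dball d x e) (finite_fset N)).
move=> _ [x _ <-]; have [c cN cx] := Nnet x.
by exists c => //=; exact: dball_recenter.
Qed.

Lemma shadow_inj : injective (@shadow R C d).
Proof. by move=> v w; exact: val_inj. Qed.

Lemma exists_vertex x e : 0 < e -> exists v, shadow v = dball d x e.
Proof.
move=> e0; have h : dball d x e \in vertices d by apply/mem_set; exists x, e.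
by exists (SigSub h).
Qed.

Lemma shadow_dball v x : shadow v x ->
  exists2 e : R, 0 < e & shadow v = dball d x e.
Proof.
have [y [e [e0 vE]]] := set_mem (valP v); rewrite /shadow vE => yx.
by exists e => //; exact: dball_recenter.
Qed.

Lemma shadow_nonempty v : exists x, shadow v x.
Proof.
have [y [e [e0 vE]]] := set_mem (valP v).
by exists y; rewrite /shadow vE; exact: dball_center.
Qed.

Lemma open_shadow v : open (shadow v).
Proof.
have [x vx] := shadow_nonempty v.
by have [e _ ->] := shadow_dball vx; exact: open_dball.
Qed.

Lemma dist_le_diam v x y : shadow v x -> shadow v y -> d x y <= diam v.
Proof.
move=> vx vy; have [e e0 vE] := shadow_dball vx.
apply: ub_le_sup; last by exists x, y.
exists e => _ [a [b [va vb ->]]]; apply/ltW; move: va vb; rewrite vE => xa xb.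
by apply: dist_ultra xb; rewrite dist_sym.
Qed.

Lemma diam_gt0 v : 0 < diam v.
Proof.
have [_ _ _ pC] := hC; have [x vx] := shadow_nonempty v.
have [y vy xy] : exists2 y, shadow v y & y <> x.
  apply: contrapT => noy; apply: ((perfectTP.1 pC) x).
  rewrite (_ : [set x] = shadow v); first exact: open_shadow.
  apply/seteqP; split => [_ -> //|y vy].
  by apply: contrapT => yx; apply: noy; exists y.
apply: lt_le_trans (dist_le_diam vx vy); rewrite lt_neqAle dist_ge0 andbT.
apply/eqP => /esym dxy; apply: xy.
by have [[[h _ _] _] _] := hd; apply/esym/h.
Qed.

(** By compactness the diameter is attained at two points of the ball, and in an
    ultrametric space two points of an open ball are closer than its radius. *)
Lemma diam_lt_radius v x e : shadow v = dball d x e -> diam v < e.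
Proof.
move=> vE; have [[a b] [/= va vb <-]] := choices_at_nonempty hC hd v.
by move: va vb; rewrite vE => xa xb; apply: dist_ultra xb; rewrite dist_sym.
Qed.

Lemma shadow_le_diam v x y : shadow v x -> d x y <= diam v -> shadow v y.
Proof.
move=> vx xy; have [e e0 vE] := shadow_dball vx.
by rewrite vE /dball /=; exact: le_lt_trans xy (diam_lt_radius vE).
Qed.

Lemma dball_diam_proper v x : shadow v x -> dball d x (diam v) `<` shadow v.
Proof.
move=> vx; split => [y xy|h]; first exact: shadow_le_diam vx (ltW xy).
have [[a b] [/= va vb ab]] := choices_at_nonempty hC hd v.
have : d a b < diam v.
  by apply: dist_ultra (h _ vb); rewrite dist_sym; exact: h.
by rewrite ab ltxx.
Qed.

Lemma proper_sub_dball v w x : shadow w `<` shadow v -> shadow w x ->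
  shadow w `<=` dball d x (diam v).
Proof.
move=> [wv nvw] wx; have [e e0 wE] := shadow_dball wx.
have [y vy wy] : exists2 y, shadow v y & ~ shadow w y.
  by apply: contrapT => h; apply: nvw => y vy; apply: contrapT => nwy; apply: h; exists y.
rewrite wE => z /lt_le_trans; apply.
apply: le_trans (dist_le_diam (wv _ wx) vy); rewrite leNgt; apply/negP => xy.
by apply: wy; rewrite wE.
Qed.

(** The children of [v] are the open balls of radius [diam v] centred in [v]:
    such a ball misses one of two points that realize the diameter, while a
    proper subball of [v] has radius at most [diam v]. *)
Lemma childP v w :
  child v w <-> exists2 x, shadow v x & shadow w = dball d x (diam v).
Proof.
split => [[wv wmax]|[x vx wE]].
  have [x wx] := shadow_nonempty w; have vx := wv.1 _ wx.
  have [u uE] := exists_vertex x (diam_gt0 v).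
  exists x => //; rewrite -uE; congr shadow; apply/esym; apply: wmax.
    by rewrite uE; exact: dball_diam_proper.
  by rewrite uE; exact: proper_sub_dball.
split; first by rewrite wE; exact: dball_diam_proper.
move=> u uv wu; apply: shadow_inj; apply/seteqP; split => //.
rewrite wE; apply: proper_sub_dball => //; apply: wu.
by rewrite wE; apply: dball_center; exact: diam_gt0.
Qed.

Lemma child_sub v w : child v w -> shadow w `<=` shadow v.
Proof. by move=> [[]]. Qed.

Lemma child_exists v x : shadow v x -> exists2 w, child v w & shadow w x.
Proof.
move=> vx; have [w wE] := exists_vertex x (diam_gt0 v); exists w.
  by apply/childP; exists x.
by rewrite wE; apply: dball_center; exact: diam_gt0.
Qed.

Lemma child_ballE v w x : child v w -> shadow w x ->
  shadow w = dball d x (diam v).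
Proof. by move=> /childP[y vy ->] => /dball_recenter. Qed.

Lemma finite_children v : finite_set (child v).
Proof.
apply: (@sub_finite_set _ _ ((@shadow R C d) @^-1`
  (range (fun x => dball d x (diam v))))).
  by move=> w /childP[x _ wE]; exists x.
apply: finite_preimage; last exact: finite_dballs.
by move=> ? ? _ _; exact: shadow_inj.
Qed.

Lemma choices_atE v :
  choices_at v = \bigcup_(p in child_pairs v) (shadow p.1 `*` shadow p.2).
Proof.
apply/seteqP; split => [[x y] [/= vx vy xy]|].
  have [w1 vw1 w1x] := child_exists vx; have [w2 vw2 w2y] := child_exists vy.
  exists (w1, w2) => //; split => //= w12.
  have := w2y; rewrite -w12 (child_ballE vw1 w1x) /dball /= xy.
  by rewrite ltxx.
move=> [x y] [[w1 w2] [/= vw1 vw2 w12] [/= w1x w2y]]; split => /=.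
- exact: child_sub vw1 _ w1x.
- exact: child_sub vw2 _ w2y.
apply/eqP; rewrite eq_le; apply/andP; split.
  by apply: dist_le_diam; [exact: child_sub vw1 _ w1x|exact: child_sub vw2 _ w2y].
rewrite leNgt; apply/negP => xy; apply: w12; apply: shadow_inj.
by rewrite (child_ballE vw1 w1x) (child_ballE vw2 w2y); exact: dball_recenter.
Qed.

Lemma trivIset_child_pairs v :
  trivIset (child_pairs v) (fun p => shadow p.1 `*` shadow p.2).
Proof.
move=> [a1 a2] [b1 b2] [/= va1 va2 _] [/= vb1 vb2 _].
move=> [[x y] [[/= a1x a2y] [/= b1x b2y]]].
by congr pair; apply: shadow_inj;
  rewrite ?(child_ballE va1 a1x) ?(child_ballE vb1 b1x)
          ?(child_ballE va2 a2y) ?(child_ballE vb2 b2y).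
Qed.

Lemma finite_child_pairs v : finite_set (child_pairs v).
Proof.
apply: (@sub_finite_set _ _ (child v `*` child v)); first by move=> p [].
by apply: finite_setX; exact: finite_children.
Qed.

(** Such a vertex is a union of balls of radius [e], so it is determined by the
    points of a finite [e]-net that it contains. *)
Lemma finite_large_vertices (e : R) : 0 < e ->
  finite_set [set v : vertex d | e <= diam v].
Proof.
move=> e0; have [N Nnet] := exists_finite_net e0.
pose trace_of v : {fset C} := [fset c in N | `[< shadow v c >]]%fset.
have sub v w : e <= diam v -> e <= diam w -> trace_of v = trace_of w ->
    shadow v `<=` shadow w.
  move=> ev ew vw x vx; have [c cN cx] := Nnet x.
  have : c \in trace_of v.
    rewrite !inE cN /=; apply/asboolP; apply: shadow_le_diam vx _.
    by rewrite dist_sym; exact: le_trans (ltW cx) ev.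
  rewrite vw !inE => /andP[_ /asboolP wc].
  by apply: shadow_le_diam wc _; exact: le_trans (ltW cx) ew.
have inj : {in [set v : vertex d | e <= diam v] &, injective trace_of}.
  move=> v w /set_mem /= ev /set_mem /= ew vw; apply: shadow_inj.
  by apply/seteqP; split; apply: sub.
rewrite -(eq_finite_set (inj_card_eq inj)).
apply: (@sub_finite_set _ _ [set` fpowerset N]); last exact: finite_fset.
move=> _ [v _ <-] /=; rewrite fpowersetE; exact: fset_sub.
Qed.

Lemma countable_vertices : countable [set: vertex d].
Proof.
have -> : [set: vertex d] =
    \bigcup_n [set v : vertex d | n.+1%:R^-1 <= diam v].
  apply/esym; rewrite -subTset => v _.
  have h := diam_gt0 v.
  exists (Num.truncn (diam v)^-1) => //=.
  rewrite invf_ple ?posrE ?invr_gt0//.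
  by apply/ltW; exact: truncnS_gt.
apply: bigcup_countable => // n _; apply: finite_set_countable.
by apply: finite_large_vertices; rewrite invr_gt0.
Qed.

End michon_geometry.
(** * Step functions are the locally constant functions *)

Section step_functions.
Context {R : realType} {C : ptopologicalType} {d : C -> C -> R}.
Context (hC : cantor_set R C) (hd : regular_ultrametric d).
Implicit Types (v w : vertex d) (x y z : C) (f g : C -> R).

Definition constant_at_scale (e : R) f := forall x y, d x y < e -> f x = f y.

Definition locally_constant f := exists2 e, 0 < e & constant_at_scale e f.

Lemma locally_constant2 (op : R -> R -> R) f g :
  locally_constant f -> locally_constant g ->
  locally_constant (fun x => op (f x) (g x)).
Proof.
move=> [e e0 ef] [e' e'0 e'g]; exists (Num.min e e').
  by rewrite lt_min e0 e'0.
by move=> x y; rewrite lt_min => /andP[/ef -> /e'g ->].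
Qed.

Lemma locally_constant_cst (c : R) : locally_constant (fun=> c).
Proof. by exists 1. Qed.

Lemma locally_constant_comp (op : R -> R) f :
  locally_constant f -> locally_constant (fun x => op (f x)).
Proof. by move=> [e e0 ef]; exists e => // x y /ef ->. Qed.

Lemma locally_constant_shadow v : locally_constant (\1_(shadow v) : C -> R).
Proof.
exists (diam v); first exact: (diam_gt0 hC hd).
move=> x y xy; rewrite !indicE; congr (nat_of_bool _)%:R.
apply/idP/idP => /set_mem h; apply/mem_set;
  apply: (shadow_le_diam hC hd h); first exact: ltW.
by rewrite (dist_sym hd); exact: ltW.
Qed.

(** Conversely to the evident implication, a function constant at scale [e] is
    the combination of the indicators of the finitely many balls of radius [e],
    each of which is a vertex; these are pairwise disjoint, so at every point
    one term survives. *)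
Lemma step_spaceP f : step_space d f <-> locally_constant f.
Proof.
split=> [[n [c [v ->]]]|[e e0 ef]].
  elim: n c v => [|n IH] c v.
    rewrite (_ : (fun _ => _) = fun=> 0); first exact: locally_constant_cst.
    by apply/funext => x; rewrite big_ord0.
  rewrite (_ : (fun _ => _) = fun x =>
    \sum_(i < n) c (widen_ord (leqnSn n) i)
      * \1_(shadow (v (widen_ord (leqnSn n) i))) x +
    c ord_max * \1_(shadow (v ord_max)) x); last first.
    by apply/funext => x; rewrite big_ord_recr.
  apply: (locally_constant2 +%R); first exact: IH.
  exact: locally_constant_comp (locally_constant_shadow _).
(* [s] lists the vertices that are balls of radius [e]. *)
have [s sP] : exists s : seq (vertex d),
    [set` s] = [set v : vertex d | exists x, shadow v = dball d x e].
  have /finite_seqP[s ->] : finite_set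
      [set v : vertex d | exists x, shadow v = dball d x e]; last by exists s.
  apply: (@sub_finite_set _ _ ((@shadow R C d) @^-1`
    (range (fun x => dball d x e)))); first by move=> v [x vE]; exists x.
  apply: finite_preimage; last exact: (finite_dballs hC hd).
  by move=> ? ? _ _; exact: shadow_inj.
have {}sP v : v \in undup s <-> exists x, shadow v = dball d x e.
  rewrite mem_undup.
  by move: sP => /seteqP[h1 h2]; split; [exact: h1|exact: h2].
set t := undup s in sP.
have [pt ptP] := choice (@shadow_nonempty R C d hd).
exists (size t), (fun i => f (pt (tnth (in_tuple t) i))), (tnth (in_tuple t)).
apply/funext => x.
rewrite -(big_tuple _ _ (in_tuple t) predT (fun v => f (pt v) * \1_(shadow v) x)).
have [w wE] := @exists_vertex R C d x e e0.
have wt : w \in t by apply/sP; exists x.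
have wx : shadow w x by rewrite wE; exact: (dball_center hd).
rewrite /= (bigD1_seq w)//= ?undup_uniq// big_seq_cond big1 ?addr0; last first.
  move=> v /andP[/sP[y vE] vw]; rewrite indicE memNset ?mulr0// => vx.
  move: vw; rewrite (_ : v = w) ?eqxx//; apply: shadow_inj; rewrite wE vE.
  by apply: (dball_recenter hd); move: vx; rewrite vE.
rewrite indicE mem_set// mulr1; apply: ef.
by have := ptP w; rewrite wE.
Qed.

Lemma open_measurable_borel (A : set C) : open A -> measurable (A : set (borel C)).
Proof. by move=> oA; exact: sub_sigma_algebra. Qed.

Lemma measurable_shadow v : measurable (shadow v : set (borel C)).
Proof. by apply: open_measurable_borel; exact: (open_shadow hd). Qed.

Lemma measurable_step f : step_space d f ->
  measurable_fun [set: borel C] (f : borel C -> R).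
Proof.
move=> [n [c [v ->]]]; apply: measurable_sum => i.
apply: measurable_funM => //; apply: measurable_indic; exact: measurable_shadow.
Qed.

Lemma step_bounded f : step_space d f -> exists M : R, forall x, `|f x| <= M.
Proof.
move=> [n [c [v ->]]]; exists (\sum_(i < n) `|c i|) => x.
apply: le_trans (ler_norm_sum _ _ _) _; apply: ler_sum => i _.
by rewrite normrM ler_piMr// indicE; case: (_ \in _); rewrite ?normr1 ?normr0.
Qed.

End step_functions.
Arguments constant_at_scale {R C} d e f.
Arguments locally_constant {R C} d f.
(** * The measure on the space of choices *)

Section local_choices.
Context {R : realType} {C : ptopologicalType} {d : C -> C -> R}.
Context (hC : cantor_set R C) (hd : regular_ultrametric d).
Context (mu : probability (borel C) R).
Context (hmass : forall v : vertex d, nu_mass mu v != 0%E).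
Implicit Types (v w : vertex d).
Local Open Scope ereal_scope.

Lemma measurable_choices_at v :
  measurable (choices_at v : set (borel C * borel C)).
Proof.
rewrite (choices_atE hC hd); apply: fin_bigcup_measurable.
  exact: (finite_child_pairs hC hd).
by move=> p _; apply: measurableX; exact: (measurable_shadow hd).
Qed.

(** Two points of [v] are at distance [diam v] exactly when they lie in distinct
    children, and [v] has finitely many children. *)
Lemma nu_massE v : nu_mass mu v = (mu \x mu) (choices_at v).
Proof.
rewrite (choices_atE hC hd) measure_fin_bigcup; last 3 first.
- exact: (finite_child_pairs hC hd).
- exact: (trivIset_child_pairs hC hd).
- by move=> p _; apply: measurableX; exact: (measurable_shadow hd).
rewrite /nu_mass esum_fset; last 2 first.
- exact: (finite_child_pairs hC hd).
- by move=> p _; exact: mule_ge0.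
apply: eq_fsbigr => p _; apply: esym; apply: product_measure1E;
  exact: (measurable_shadow hd).
Qed.

Lemma product_setT : (mu \x mu) [set: borel C * borel C] = 1.
Proof.
have mu1 : mu setT = 1 := probability_setT mu.
rewrite -setXTT; transitivity (mu setT * mu setT); last by rewrite mu1 mule1.
exact: product_measure1E.
Qed.

Lemma nu_mass_le1 v : nu_mass mu v <= 1.
Proof.
rewrite nu_massE -product_setT; apply: le_measure => //; apply/mem_set; first exact: measurable_choices_at.
exact: measurableT.
Qed.

Lemma nu_mass_fin v : exists2 m : R, (0 < m)%R & nu_mass mu v = m%:E.
Proof.
have m0 : 0 <= nu_mass mu v by rewrite nu_massE; exact: measure_ge0.
have m1 := nu_mass_le1 v; have mn0 := hmass v.
have mfin : nu_mass mu v \is a fin_num.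
  by rewrite ge0_fin_numE// (le_lt_trans m1)// ltry.
exists (fine (nu_mass mu v)); last by rewrite fineK.
by rewrite fine_gt0// lt_neqAle eq_sym mn0 m0 (le_lt_trans m1) ?ltry.
Qed.

(** If [v] had mass zero, so would all its children, and the normalizing
    constant would vanish. *)
Lemma shadow_mass_gt0 v : 0 < mu (shadow v).
Proof.
rewrite lt_neqAle measure_ge0 andbT eq_sym; apply/eqP => v0.
have [/= m m0] := nu_mass_fin v; rewrite /nu_mass esum1 => [[m0']|p].
  by move: m0; rewrite -m0' ltxx.
move=> [vp1 _ _]; suff -> : mu (shadow p.1) = 0 by rewrite mul0e.
apply/eqP; rewrite eq_le measure_ge0 andbT -v0.
apply: le_measure; [..|exact: child_sub vp1];
  apply/mem_set; exact: (measurable_shadow hd).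
Qed.

Lemma exists_nu_at v : exists P : probability (borel C * borel C)%type R,
  forall B, P B = nu_at mu v B.
Proof.
exists (mnormalize (mrestr (mu \x mu) (measurable_choices_at v)) (dirac point)).
move=> B; have [m m0 mE] := nu_mass_fin v.
have ET : mrestr (mu \x mu) (measurable_choices_at v) setT = m%:E.
  by rewrite /mrestr -mE nu_massE setTI.
have key (nu : {measure set (borel C * borel C) -> \bar R}) Q :
    nu setT = m%:E -> mnormalize nu Q B = nu B * (m^-1)%:E.
  by move=> E; rewrite /mnormalize E !eqe (gt_eqF m0).
apply: etrans (key _ _ ET) _.
by rewrite /nu_at mE inver (gt_eqF m0).
Qed.

End local_choices.
Section choice_space.
Context {R : realType} {C : ptopologicalType} {d : C -> C -> R}.
Context (hC : cantor_set R C) (hd : regular_ultrametric d).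
Context (mu : probability (borel C) R).
Context (hmass : forall v : vertex d, nu_mass mu v != 0%E).
Implicit Types (v w : vertex d).

Local Notation pairs := (borel C * borel C)%type.

Lemma measurable_choice_eval v :
  measurable_fun [set: UpsilonM hC hd] (fun tau : UpsilonM hC hd =>
    choice_eval (tau : choice_fun d) v : pairs).
Proof.
move=> _ B mB; rewrite setTI; apply: sub_sigma_algebra.
by exists v, B.
Qed.

(** The product measure lives on all families of pairs; pairs that are not
    admissible are sent to a default choice.  They form a null set for [nu_at],
    so the retraction does not change the marginals. *)
Definition choice_retract v (p : pairs) : pairs :=
  if `[< choices_at v p >] then p
  else choice_eval (default_choice hC hd) v.

Lemma choice_retract_in v p : choices_at v (choice_retract v p).
Proof.
rewrite /choice_retract; case: ifPn => [/asboolP//|_].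
exact: (set_mem (valP (default_choice hC hd)) v).
Qed.

Lemma measurable_choice_retract v : measurable_fun setT (choice_retract v).
Proof.
apply: measurable_fun_ifT => //.
apply: (measurable_fun_bool true).
rewrite setTI (_ : _ @^-1` _ = choices_at v); first exact: measurable_choices_at.
by apply/seteqP; split => p /=; [move/asboolP|move/asboolP ->].
Qed.

Lemma choice_fun_of_subproof (h : vertex d -> pairs) :
  (fun v => choice_retract v (h v)) \in @choice_functions R C d.
Proof. by apply/mem_set => v; exact: choice_retract_in. Qed.

Definition choice_fun_of (h : vertex d -> pairs) : UpsilonM hC hd :=
  (SigSub (choice_fun_of_subproof h) : choice_fun d).

Lemma measurable_choice_fun_of (g : vertex d -> nat) :
  measurable_fun [set: sequence_space pairs]
    (fun w : sequence_space pairs => choice_fun_of (w \o g)).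
Proof.
apply: (@measurability _ _ _ (UpsilonM hC hd) setT _
  (@Upsilon_cylinders R C d hC hd)) => //.
move=> _ [_ [v [B [mB ->]]] <-]; rewrite setTI.
have := measurableT_comp (measurable_choice_retract v)
  (measurable_coordinate (X := pairs) (g v)).
by move=> /(_ measurableT B mB); rewrite setTI.
Qed.

(** The vertices are countable: number them injectively by [g], put the measure
    of [v] on the coordinate [g v] (and a Dirac mass on the coordinates that
    number no vertex), and push the product forward to the choice functions. *)
Theorem exists_nu : exists nu : probability (UpsilonM hC hd) R, is_nu mu nu.
Proof.
have [P PE] := choice (exists_nu_at hC hd hmass).
have /countable_injP[g ginj] := countable_vertices hC hd.
have {}ginj v w : g v = g w -> v = w by apply: ginj; exact/mem_set.
have /choice[PP PPE] (n : nat) :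
    exists Q : probability pairs R, forall v, g v = n -> Q = P v.
  have [[v vn]|nov] := pselect (exists v, g v = n).
    by exists (P v) => w wn; congr P; apply: ginj; rewrite wn vn.
  by exists (dirac point) => v vn; exfalso; apply: nov; exists v.
have [Q QE] := sequence_product PP.
pose rho_mfun := isMeasurableFun.Build _ _ _ _ _ (measurable_choice_fun_of g).
pose rho : {mfun sequence_space pairs >-> UpsilonM hC hd} :=
  HB.pack (fun w : sequence_space pairs => choice_fun_of (w \o g)) rho_mfun.
exists (distribution Q rho) => r B ur mB.
pose B' n : set pairs := [set p | forall v, g v = n -> B v (choice_retract v p)].
have B'E v : B' (g v) = choice_retract v @^-1` B v.
  by apply/seteqP; split=> p /= h; [exact: h|move=> w /ginj ->].
have mretr v : measurable (choice_retract v @^-1` B v).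
  by rewrite -[X in measurable X]setTI; exact: measurable_choice_retract.
have mB' n : measurable (B' n).
  have [[v <-]|nov] := pselect (exists v, g v = n); first by rewrite B'E.
  rewrite (_ : B' n = setT)// -subTset => p _ v vn.
  by exfalso; apply: nov; exists v.
transitivity (Q (box (map g r) B')).
  apply: (congr1 (Q : set _ -> \bar R)); apply/seteqP; split => w /= h.
    by move=> _ /mapP[v vr ->] u /ginj ->; exact: h.
  by move=> v vr; apply: (h (g v) (map_f g vr)).
rewrite QE//; last by rewrite map_inj_in_uniq// => v w _ _; exact: ginj.
rewrite big_map; apply: eq_bigr => v _.
rewrite (PPE _ v erefl) B'E PE /nu_at; congr (_ / _)%E; congr ((mu \x mu)%E _).
apply/seteqP; split => p [/= h vp]; split => //; move: h; rewrite /choice_retract;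
  by move/asboolP: vp => ->.
Qed.

(** The prescribed values determine the measure on the events that constrain
    finitely many vertices, which are stable under intersection. *)
Theorem nu_unique (nu nu' : probability (UpsilonM hC hd) R) :
  is_nu mu nu -> is_nu mu nu' -> forall X, measurable X -> nu' X = nu X.
Proof.
move=> nuP nu'P; pose cyl : set (set (UpsilonM hC hd)) :=
  [set X | exists (r : seq (vertex d)) (B : vertex d -> set pairs),
    [/\ uniq r, forall v, measurable (B v) &
        X = [set tau : choice_fun d | forall v, v \in r -> B v (tau v)]]].
have cylT : cyl setT.
  by exists [::], (fun=> setT); split => //; apply/esym; rewrite -subTset.
apply: (measure_unique cyl (fun=> setT)) => //.
- apply/seteqP; split.
    apply: sub_smallest2r; first exact: smallest_sigma_algebra.
    move=> _ [v [B [mB ->]]].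
    exists [:: v], (fun=> B); split => //; apply/seteqP; split => tau /= h.
      by move=> w; rewrite inE => /eqP ->.
    by apply: h; rewrite inE.
  apply: smallest_sub; first exact: (@sigma_algebra_measurable _ (UpsilonM hC hd)).
  move=> _ [r [B [_ mB ->]]]; elim: r => [|v r IH].
    rewrite (_ : [set _ | _] = setT); first exact: measurableT.
    by rewrite -subTset.
  rewrite (_ : [set _ | _] = [set tau : choice_fun d | B v (tau v)] `&`
     [set tau : choice_fun d | forall v, v \in r -> B v (tau v)]).
    apply: measurableI => //; apply: sub_sigma_algebra; by exists v, (B v).
  apply/seteqP; split => tau /=.
    by move=> h; split=> [|w wr]; apply: h; rewrite inE ?eqxx ?wr ?orbT.
  by move=> [h1 h2] w; rewrite inE => /predU1P[->//|]; exact: h2.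
- move=> _ _ [r [B [ur mB ->]]] [r' [B' [ur' mB' ->]]].
  exists (undup (r ++ r')), (fun v => (if v \in r then B v else setT) `&`
    (if v \in r' then B' v else setT)); split.
  + exact: undup_uniq.
  + by move=> v; apply: measurableI; case: ifP.
  + apply/seteqP; split => tau /=.
      by move=> [h h'] v _; split; case: ifP => // vr; [exact: h|exact: h'].
    move=> h; split => v vr; have := h v;
      rewrite mem_undup mem_cat vr ?orbT => /(_ isT)[] //.
- by rewrite bigcup_const.
- by move=> _ [r [B [ur mB ->]]]; rewrite [LHS]nu'P// [RHS]nuP.
- by move=> _; rewrite [X in (X < _)%E](probability_setT nu') ltry.
Qed.

End choice_space.
(** * Traces of fibrewise operators and the trace formula *)

Section finitely_supported_sums.
Context {R : realType} {I : choiceType}.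

Lemma esum_finite_support (a : I -> \bar R) (s : seq I) :
  uniq s -> (forall i, i \notin s -> a i = 0%E) -> (forall i, (0 <= a i)%E) ->
  (\esum_(i in [set: I]) a i = \sum_(i <- s) a i)%E.
Proof.
move=> us as0 a0; rewrite fsbig_seq// -esum_fset//.
rewrite [RHS]esum_mkcond; apply: eq_esum => i _.
by case: ifPn => //; rewrite mem_setE => /as0.
Qed.

Lemma rsum_finite_support (F : I -> R) (s : seq I) :
  uniq s -> (forall i, i \notin s -> F i = 0) -> rsum F = \sum_(i <- s) F i.
Proof.
move=> us Fs; rewrite /rsum.
rewrite !(@esum_finite_support _ s)//; first last.
- by move=> i; rewrite lee_fin le_max lexx orbT.
- by move=> i /Fs ->; rewrite maxxx.
- by move=> i; rewrite lee_fin le_max lexx orbT.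
- by move=> i /Fs ->; rewrite oppr0 maxxx.
rewrite !sumEFin /= -sumrB; apply: eq_bigr => i _.
by case: (leP (F i) 0); case: (leP (- F i) 0); lra.
Qed.

Lemma csum_finite_support (F : I -> R[i]) (s : seq I) :
  uniq s -> (forall i, i \notin s -> F i = 0) -> csum F = \sum_(i <- s) F i.
Proof.
move=> us Fs; rewrite /csum !(@rsum_finite_support _ s)//; last 2 first.
- by move=> i /Fs ->.
- by move=> i /Fs ->.
elim: s {us Fs} => [|i s IH]; first by rewrite !big_nil.
by rewrite !big_cons -IH; case: (F i) => a b.
Qed.

End finitely_supported_sums.

Section fibrewise_operators.
Context {R : realType} {C : topologicalType} {d : C -> C -> R}.
Local Notation V := (vertex d).
Implicit Types (M N : V -> 'M[R[i]]_2) (v w : V).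

(** The operators that act on each fibre of the Hilbert space through a matrix.
    All the operators of the statement are of this form. *)
Definition fibre_op M : operator d := fun psi v => M v *m psi v.

Lemma inner_fibre (psi phi : spinor d) v :
  (forall w, w != v -> psi w = 0) ->
  inner psi phi = \sum_(k < 2) (psi v k 0)^* * phi v k 0.
Proof.
move=> psi0; rewrite /inner (@csum_finite_support _ _ _ [seq (v, k) | k <- enum 'I_2]).
- by rewrite big_map big_enum.
- by rewrite map_inj_uniq ?enum_uniq// => i j [].
move=> [w k] /= wk; rewrite psi0 ?mxE ?conjC0 ?mul0r//.
apply: contraNneq wk => ->; apply: map_f; exact: mem_enum.
Qed.

Lemma hbasis_out (i : V * 'I_2) w : w != i.1 -> hbasis i w = 0.
Proof. by rewrite /hbasis => /negbTE ->. Qed.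

Lemma hbasisE (i : V * 'I_2) : hbasis i i.1 = delta_mx i.2 0.
Proof. by rewrite /hbasis eqxx. Qed.

Lemma adjoint_fibre_op M :
  adjoint (fibre_op M) = fibre_op (fun v => (map_mx Num.conj (M v))^T).
Proof.
apply/funext => psi; apply/funext => v; apply/colP => j.
rewrite mxE (@inner_fibre _ _ v); last first.
  by move=> w wv; rewrite /fibre_op hbasis_out// mulmx0.
rewrite /fibre_op mxE; apply: eq_bigr => k _; rewrite !mxE.
congr (Num.conj _ * _); rewrite (bigD1 j)//= big1 ?addr0 => [|l lj].
  by rewrite (hbasisE (v, j)) mxE !eqxx mulr1.
by rewrite (hbasisE (v, j)) mxE (negbTE lj) mulr0.
Qed.

Lemma mx_entry_fibre_op M i j :
  mx_entry (fibre_op M) i j = if i.1 == j.1 then M i.1 i.2 j.2 else 0.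
Proof.
rewrite /mx_entry (@inner_fibre _ _ i.1); last exact: hbasis_out.
rewrite (bigD1 i.2)//= big1 ?addr0 => [|k ki]; last first.
  rewrite hbasisE mxE (negbTE ki) /= mulr0n. by rewrite conjC0 mul0r.
rewrite hbasisE mxE !eqxx /= mulr1n conjC1 mul1r /fibre_op mxE.
have [->|ij] := eqVneq i.1 j.1; last first.
  by rewrite big1// => k _; rewrite hbasis_out// mxE mulr0.
rewrite (bigD1 j.2)//= big1 ?addr0 => [|k kj].
  by rewrite hbasisE mxE !eqxx mulr1.
by rewrite hbasisE mxE (negbTE kj) mulr0.
Qed.

Lemma trace_fibre_op M (s : seq V) : uniq s ->
  (forall v, v \notin s -> M v = 0) ->
  trace_summable (fibre_op M) /\ trace (fibre_op M) = \sum_(v <- s) \tr (M v).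
Proof.
move=> us Ms; pose t := [seq (v, k) | v <- s, k <- enum 'I_2].
have ut : uniq t.
  by apply: allpairs_uniq => //; [exact: enum_uniq|move=> [? ?] [? ?] _ _ /= [-> ->]].
have tP v k : (v, k) \notin t -> v \notin s.
  by apply: contraNN => vs; apply: allpairs_f => //; exact: mem_enum.
split.
  rewrite /trace_summable (@esum_finite_support _ _ _ [seq (p, q) | p <- t, q <- t]).
  - apply: lte_sum_pinfty => p _; exact: ltry.
  - by apply: allpairs_uniq => // -[? ?] [? ?] _ _ /= [-> ->].
  - move=> [[v k] [w l]] h; rewrite mx_entry_fibre_op [X in X == _]/=.
    case: eqVneq => [/= vw|_]; last by rewrite ComplexField.Normc.normc0.
    rewrite Ms ?mxE ?ComplexField.Normc.normc0//.
    apply: contraNN h => vs; apply: allpairs_f; apply: allpairs_f;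
      by rewrite -?vw ?mem_enum.
  - by move=> p; rewrite lee_fin; case: (mx_entry _ _ _) => a b; rewrite sqrtr_ge0.
rewrite /trace (@csum_finite_support _ _ _ t)//; last first.
  by move=> [v k] /tP vs; rewrite /= mx_entry_fibre_op eqxx Ms ?mxE.
rewrite /t big_allpairs_dep; apply: eq_bigr => v _.
by rewrite big_enum; apply: eq_bigr => k _; rewrite mx_entry_fibre_op eqxx.
Qed.

End fibrewise_operators.
Section trace_of_form.
Context {R : realType} {C : ptopologicalType} {d : C -> C -> R}.
Context (hC : cantor_set R C) (hd : regular_ultrametric d).
Implicit Types (v w : vertex d) (tau : choice_fun d) (f g : C -> R).

Definition jump f (p : C * C) : R := f p.1 - f p.2.

Definition weight (s : R) v : R := diam v `^ s * (diam v)^-1 ^+ 2.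

Lemma weight_ge0 s v : 0 <= weight s v.
Proof. by rewrite mulr_ge0 ?powR_ge0// sqr_ge0. Qed.

Definition commutator_mx tau (f : C -> R[i]) v : 'M[R[i]]_2 :=
  \matrix_(i, j) (((diam v)^-1)%:C * (i != j)%:R *
    ((if j == 0 then f (tau v).1 else f (tau v).2) -
     (if i == 0 then f (tau v).1 else f (tau v).2))).

Lemma commutator_dirac_repr tau (f : C -> R[i]) :
  commutator (dirac_op (d := d)) (repr_op tau f) = fibre_op (commutator_mx tau f).
Proof.
apply/funext => psi; apply/funext => v.
rewrite /commutator /dirac_op /repr_op /fibre_op -scalemxAr -scalerBr.
rewrite !mulmxA -mulmxBl scalemxAl; congr (_ *m _); apply/matrixP => i j.
rewrite mul_mx_diag mul_diag_mx !mxE -mulrA; congr (_ * _).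
by rewrite mulrBr [X in _ - X]mulrC.
Qed.

Lemma form_opE s tau (f g : C -> R[i]) : form_op s tau f g =
  fibre_op (fun v => (diam v `^ s)%:C *:
    ((map_mx Num.conj (commutator_mx tau f v))^T *m commutator_mx tau g v)).
Proof.
rewrite /form_op !commutator_dirac_repr adjoint_fibre_op.
apply/funext => psi; apply/funext => v.
by rewrite /= /abs_dirac_powN /fibre_op mulmxA scalemxAl.
Qed.

Lemma conj_real (a : R) : Num.conj (a%:C : R[i]) = a%:C.
Proof. exact: conjc_real. Qed.

Lemma mxtrace_form s tau f g v :
  \tr ((diam v `^ s)%:C *:
    ((map_mx Num.conj (commutator_mx tau (fun x => (f x)%:C) v))^T *m
      commutator_mx tau (fun x => (g x)%:C) v)) =
  (2 * (weight s v * (jump f (tau v) * jump g (tau v))))%:C :> R[i].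
Proof.
rewrite mxtraceZ /mxtrace !big_ord_recl big_ord0 !mxE !big_ord_recl !big_ord0.
rewrite !mxE /= !mulr0n !mulr1n !(mulr0, mul0r, mulr1, addr0, add0r, conjC0).
rewrite -!rmorphB -!rmorphM /= !conj_real -!rmorphM -rmorphD -rmorphM.
congr (_%:C); rewrite /weight /jump; ring.
Qed.

Lemma commutator_mx0 tau (f : C -> R[i]) v :
  f (tau v).1 = f (tau v).2 -> commutator_mx tau f v = 0.
Proof.
by move=> fE; apply/matrixP => i j; rewrite !mxE fE !if_same subrr mulr0.
Qed.

Lemma choice_in tau v : choices_at v (tau v).
Proof. exact: (set_mem (valP tau) v). Qed.

Lemma jump_small tau f e v : constant_at_scale d e f -> diam v < e ->
  jump f (tau v) = 0.
Proof.
move=> fe ve; rewrite /jump; have [_ _ h] := choice_in tau v.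
by rewrite (fe _ (tau v).2) ?subrr// h.
Qed.

(** The vertices off [l] do not contribute: their diameter is below the scale of
    [g], so the jumps of [g] over them vanish. *)
Lemma trace_form s tau f g e (l : seq (vertex d)) : constant_at_scale d e g ->
  uniq l -> (forall v, v \notin l -> diam v < e) ->
  let A := form_op s tau (fun x => (f x)%:C) (fun x => (g x)%:C) in
  trace_summable A /\
  trace A = (2 * \sum_(v <- l) weight s v * (jump f (tau v) * jump g (tau v)))%:C.
Proof.
move=> ge ul le; rewrite /= form_opE.
have [|tA tE] := @trace_fibre_op R C d (fun v => (diam v `^ s)%:C *:
    ((map_mx Num.conj (commutator_mx tau (fun x => (f x)%:C) v))^T *m
      commutator_mx tau (fun x => (g x)%:C) v)) l ul.
  move=> v /le ve; rewrite [X in _ *m X]commutator_mx0 ?mulmx0 ?scaler0//.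
  by apply/eqP; rewrite -subr_eq0 -rmorphB; have := jump_small tau ge ve;
    rewrite /jump => ->; rewrite rmorph0.
split => //; rewrite tE mulr_sumr rmorph_sum /=; apply: eq_bigr => v _.
exact: mxtrace_form.
Qed.

Lemma exists_large_vertices (e : R) : 0 < e ->
  exists l : seq (vertex d), uniq l /\ forall v, v \notin l -> diam v < e.
Proof.
move=> e0; have /finite_seqP[l lE] := finite_large_vertices hC hd e0.
exists (undup l); split=> [|v]; first exact: undup_uniq.
rewrite mem_undup ltNge => vl; apply/negP => ev.
have : [set v : vertex d | e <= diam v] v by [].
by rewrite lE /= (negbTE vl).
Qed.

End trace_of_form.
(** * Energies of step functions *)

Section square_integrals.
Context {dd : measure_display} {T : measurableType dd} {R : realType}.
Context (mu : {measure set T -> \bar R}).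
Implicit Types (f g : T -> R).
Local Open Scope ereal_scope.

Definition sqnorm f : \bar R := \int[mu]_x (f x ^+ 2)%:E.

Lemma sqnormE f : sqnorm f = 'N[mu]_2%:E[EFin \o f] `^ 2.
Proof.
rewrite poweR_Lnorm//; apply: eq_integral => x _.
transitivity ((`|f x| `^ 2)%R%:E); last by rewrite -poweR_EFin.
by rewrite powR_mulrn ?normr_ge0// real_normK// num_real.
Qed.

(** Norm estimates become estimates of the integral of the square, without
    fractional powers. *)
Lemma Lnorm2_lt f (r : R) : (0 < r)%R ->
  ('N[mu]_2%:E[EFin \o f] < r%:E) = (sqnorm f < (r ^+ 2)%:E).
Proof.
move=> r0; rewrite sqnormE.
have rE : r%:E `^ 2 = (r ^+ 2)%:E by rewrite poweR_EFin powR_mulrn ?ltW.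
have nng (x : \bar R) : 0 <= x -> x \in `[0, +oo].
  by move=> x0; rewrite in_itv/= leey x0.
have sqrK (x : \bar R) : 0 <= x -> (x `^ 2) `^ 2^-1 = x.
  by move=> x0; rewrite -poweRrM mulfV// poweRe1.
have r0' : 0 <= r%:E by rewrite lee_fin ltW.
apply/idP/idP; rewrite -rE !ltNge; apply: contraNN => h.
  rewrite -(sqrK _ r0') -(sqrK 'N[mu]_2%:E[EFin \o f]) ?Lnorm_ge0//.
  apply: gt0_ler_poweR h; rewrite ?invr_ge0//; apply: nng; exact: poweR_ge0.
by apply: gt0_ler_poweR h => //; apply: nng; rewrite ?Lnorm_ge0.
Qed.

End square_integrals.

Section transport.
Context {d1 d2 : measure_display} {T1 : measurableType d1}
  {T2 : measurableType d2} {R : realType}.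
Local Open Scope ereal_scope.

(** Applied below to the two coordinates of a random choice, whose laws are
    dominated by a multiple of [mu]. *)
Lemma ge0_integral_comp_le (m1 : probability T1 R)
    (m2 : {measure set T2 -> \bar R}) (phi : T1 -> T2) (c : R)
    (h : T2 -> \bar R) :
  measurable_fun [set: T1] phi -> (0 <= c)%R ->
  (forall A, measurable A -> m1 (phi @^-1` A) <= c%:E * m2 A) ->
  measurable_fun [set: T2] h -> (forall y, 0 <= h y) ->
  \int[m1]_x h (phi x) <= c%:E * \int[m2]_y h y.
Proof.
move=> mphi c0 le12 mh h0.
pose X : {mfun T1 >-> T2} := HB.pack phi (isMeasurableFun.Build _ _ _ _ _ mphi).
have -> : \int[m1]_x h (phi x) = \int[distribution m1 X]_y h y.
  by rewrite ge0_integral_distribution.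
rewrite (_ : c = (NngNum c0)%:num)// -ge0_integral_mscale//.
by apply: ge0_le_measure_integral => // A mA; exact: le12.
Qed.

End transport.

Section energies.
Context {R : realType} {C : ptopologicalType} {d : C -> C -> R}.
Context (hC : cantor_set R C) (hd : regular_ultrametric d).
Context (mu : probability (borel C) R).
Context (hmass : forall v : vertex d, nu_mass mu v != 0%E).
Context (nu : probability (UpsilonM hC hd) R).
Context (nuP : is_nu mu nu).
Implicit Types (v w : vertex d) (f g : C -> R).

(** Forgetting the condition that the pair is admissible leaves the marginals of
    the product measure, both equal to [mu]. *)
Lemma nu_at_marginals v : exists2 c : R, 0 <= c &
  forall A : set (borel C), measurable A ->
  (nu [set tau : choice_fun d | A (tau v).1] <= c%:E * mu A)%E /\
  (nu [set tau : choice_fun d | A (tau v).2] <= c%:E * mu A)%E.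
Proof.
have [m m0 mE] := nu_mass_fin hC hd hmass v; exists m^-1; first by rewrite invr_ge0 ltW.
have key (B : set (borel C * borel C)) : measurable B ->
    (nu [set tau : choice_fun d | B (tau v)] <= m^-1%:E * (mu \x mu) B)%E.
  move=> mB; have := nuP (r := [:: v]) (B := fun=> B) isT (fun=> mB).
  rewrite big_seq1.
  have -> : [set tau : choice_fun d | forall w, w \in [:: v] -> B (tau w)] =
      [set tau : choice_fun d | B (tau v)].
    apply/seteqP; split => tau /= h; first by apply: h; rewrite inE.
    by move=> w; rewrite inE => /eqP ->.
  move=> ->; rewrite /nu_at mE inver (gt_eqF m0) muleC.
  rewrite lee_pmul2l ?lte_fin ?invr_gt0//; apply: le_measure => //; apply/mem_set => //.
  exact: measurableI (measurable_choices_at hC hd v).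
have mu1 : mu setT = 1%E := probability_setT mu.
move=> A mA; split.
  have := key (A `*` setT); rewrite (_ : [set _ | (_ `*` _) _] = [set tau : choice_fun d | A (tau v).1]).
    have -> : (mu \x mu)%E (A `*` setT) = (mu A * mu setT)%E.
      exact: product_measure1E.
    by rewrite mu1 mule1; apply; exact: measurableX.
  by apply/seteqP; split => tau //= [].
have := key (setT `*` A); rewrite (_ : [set _ | (_ `*` _) _] = [set tau : choice_fun d | A (tau v).2]).
  have -> : (mu \x mu)%E (setT `*` A) = (mu setT * mu A)%E.
    exact: product_measure1E.
  by rewrite mu1 mul1e; apply; exact: measurableX.
by apply/seteqP; split => tau //= [].
Qed.

Definition jump_form v f g : R :=
  \int[nu]_(tau in [set: UpsilonM hC hd])
    (jump f ((tau : choice_fun d) v) * jump g ((tau : choice_fun d) v)).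

Lemma measurable_choice1 v : measurable_fun [set: UpsilonM hC hd]
  (fun tau : UpsilonM hC hd => ((tau : choice_fun d) v).1 : borel C).
Proof.
exact: measurableT_comp measurable_fst (measurable_choice_eval v). Qed.

Lemma measurable_choice2 v : measurable_fun [set: UpsilonM hC hd]
  (fun tau : UpsilonM hC hd => ((tau : choice_fun d) v).2 : borel C).
Proof.
exact: measurableT_comp measurable_snd (measurable_choice_eval v). Qed.

Lemma measurable_jump v f : step_space d f -> measurable_fun [set: UpsilonM hC hd]
  (fun tau : UpsilonM hC hd => jump f ((tau : choice_fun d) v)).
Proof.
move=> /(measurable_step hd) mf; apply: measurable_funB.
  exact: measurableT_comp mf (measurable_choice1 v).
exact: measurableT_comp mf (measurable_choice2 v).
Qed.

Lemma integrable_jump v f g : step_space d f -> step_space d g ->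
  nu.-integrable [set: UpsilonM hC hd] (EFin \o (fun tau : UpsilonM hC hd =>
    jump f ((tau : choice_fun d) v) * jump g ((tau : choice_fun d) v))).
Proof.
move=> sf sg; apply: measurable_bounded_integrable => //.
- by rewrite (le_lt_trans (probability_le1 _ _)) ?ltry.
- by apply: measurable_funM; exact: measurable_jump.
have [M Mf] := step_bounded sf; have [N Ng] := step_bounded sg.
exists (2 * M * (2 * N)); split; first exact: num_real.
move=> r /ltW rE tau _; apply: le_trans rE; rewrite normrM.
have jb (h : C -> R) K p : (forall x, `|h x| <= K) -> `|jump h p| <= 2 * K.
  move=> hK; apply: le_trans (ler_normB _ _) _.
  by have := hK p.1; have := hK p.2; lra.
by apply: ler_pM; rewrite ?normr_ge0//; exact: jb.
Qed.

Lemma jump_form_ge0 v f : 0 <= jump_form v f f.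
Proof. by apply: Rintegral_ge0 => tau _; rewrite -expr2 sqr_ge0. Qed.

Lemma jump_formC v f g : jump_form v f g = jump_form v g f.
Proof. by apply: eq_Rintegral => tau _; rewrite mulrC. Qed.

Lemma jump_form_linear v (a : R) f f' g : step_space d f -> step_space d f' ->
  step_space d g ->
  jump_form v (fun x => a * f x + f' x) g = a * jump_form v f g + jump_form v f' g.
Proof.
move=> sf sf' sg; rewrite /jump_form -RintegralZl//; last exact: integrable_jump.
rewrite -RintegralD//; last 2 first.
- have := @integrableZl _ _ _ nu _ measurableT a _ (integrable_jump v sf sg).
  by apply: eq_integrable.
- exact: integrable_jump.
by apply: eq_Rintegral => tau _; rewrite /jump; ring.
Qed.

Lemma jump_form_le v f g : step_space d f -> step_space d g ->
  (forall x y, `|f x - f y| <= `|g x - g y|) ->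
  jump_form v f f <= jump_form v g g.
Proof.
move=> sf sg fg; apply: le_Rintegral => //; try exact: integrable_jump.
by move=> tau _; rewrite -!expr2 -real_normK ?num_real// -[leRHS]real_normK ?num_real//
  lerXn2r ?nnegrE ?normr_ge0//; exact: fg.
Qed.

(** The constant comes from [(a - b)^2 <= 2 (a^2 + b^2)] and the domination of the
    two marginals. *)
Lemma jump_form_bound v : exists2 K : R, 0 <= K &
  forall f, step_space d f ->
    ((jump_form v f f)%:E <= K%:E * sqnorm mu (f : borel C -> R))%E.
Proof.
have [c c0 cP] := nu_at_marginals v; exists (4 * c); first by rewrite mulr_ge0.
move=> f sf; have mf := measurable_step hd sf.
pose h := fun x : borel C => ((f x) ^+ 2)%:E.
have mh : measurable_fun [set: borel C] h.
  by apply/measurable_EFinP; exact: measurable_funX.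
have h0 x : (0 <= h x)%E by rewrite lee_fin sqr_ge0.
have I1 := ge0_integral_comp_le (measurable_choice1 v) c0
  (fun A mA => (cP A mA).1) mh h0.
have I2 := ge0_integral_comp_le (measurable_choice2 v) c0
  (fun A mA => (cP A mA).2) mh h0.
have m1 := measurableT_comp mh (measurable_choice1 v).
have m2 := measurableT_comp mh (measurable_choice2 v).
rewrite /jump_form /Rintegral fineK; last first.
  by apply: integrable_fin_num => //; exact: integrable_jump.
apply: (@le_trans _ _ (\int[nu]_tau (2%:E * (h ((tau : choice_fun d) v).1 +
    h ((tau : choice_fun d) v).2)))%E).
  apply: ge0_le_integral => //.
  - by move=> tau _; rewrite lee_fin -expr2 sqr_ge0.
  - by apply/measurable_EFinP; apply: measurable_funM; exact: measurable_jump.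
  - by apply: emeasurable_funM => //; exact: emeasurable_funD.
  move=> tau _; set a := f ((tau : choice_fun d) v).1.
  set b := f ((tau : choice_fun d) v).2.
  have : jump f ((tau : choice_fun d) v) * jump f ((tau : choice_fun d) v)
      <= 2 * (a ^+ 2 + b ^+ 2).
    by rewrite /jump -/a -/b; have := sqr_ge0 (a + b); nra.
  by rewrite -lee_fin.
rewrite ge0_integralZl//; last 2 first.
- by apply: emeasurable_funD.
- by move=> tau _; exact: adde_ge0.
rewrite ge0_integralD//.
have -> : ((4 * c)%:E * sqnorm mu (f : borel C -> R) =
    2%:E * (c%:E * sqnorm mu (f : borel C -> R) + c%:E * sqnorm mu (f : borel C -> R)))%E.
  rewrite -mule2n -mule_natl muleA -EFinM [in LHS]EFinM muleA.
  by congr (_%:E * _ * _)%E; lra.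
by rewrite lee_pmul2l//; exact: leeD.
Qed.

End energies.
(** * Density in the space of square-integrable functions *)

Section square_approximation.
Context {dd : measure_display} {T : measurableType dd} {R : realType}.
Context (mu : probability T R).
Implicit Types (f g h : T -> R).

Lemma measurable_sqr f : measurable_fun [set: T] f ->
  measurable_fun [set: T] (fun x => (f x ^+ 2)%:E).
Proof. by move=> mf; apply/measurable_EFinP; exact: measurable_funX. Qed.

Lemma sqnorm_le_add f g h : measurable_fun [set: T] g ->
  measurable_fun [set: T] h -> measurable_fun [set: T] f ->
  (forall x, f x ^+ 2 <= g x ^+ 2 + h x ^+ 2) ->
  (sqnorm mu f <= sqnorm mu g + sqnorm mu h)%E.
Proof.
move=> mg mh mf fgh; rewrite /sqnorm -ge0_integralD//; first last.
- exact: measurable_sqr.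
- by move=> x _; rewrite lee_fin sqr_ge0.
- exact: measurable_sqr.
- by move=> x _; rewrite lee_fin sqr_ge0.
apply: ge0_le_integral => //.
- by move=> x _; rewrite lee_fin sqr_ge0.
- exact: measurable_sqr.
- by apply: emeasurable_funD; exact: measurable_sqr.
- by move=> x _; rewrite -EFinD lee_fin.
Qed.

Lemma sqnormZ (a : R) f : measurable_fun [set: T] f ->
  sqnorm mu (fun x => a * f x) = ((a ^+ 2)%:E * sqnorm mu f)%E.
Proof.
move=> mf; rewrite /sqnorm -ge0_integralZl//; last 3 first.
- exact: measurable_sqr.
- by move=> x _; rewrite lee_fin sqr_ge0.
- by rewrite lee_fin sqr_ge0.
by apply: eq_integral => x _; rewrite exprMn EFinM.
Qed.

(** Dominated convergence; it handles both the approximation of indicators and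
    that of functions by simple functions. *)
Lemma sqnorm_cvg0 (h_ : nat -> T -> R) (G : T -> R) :
  (forall n, measurable_fun [set: T] (h_ n)) ->
  mu.-integrable [set: T] (fun x => (G x ^+ 2)%:E) ->
  (forall n x, `|h_ n x| <= G x) ->
  (forall x, h_ n x @[n --> \oo] --> (0 : R)) ->
  (sqnorm mu (h_ n) @[n --> \oo] --> 0)%E.
Proof.
move=> mh iG hG h0.
have := @dominated_cvg _ T R mu setT measurableT
  (fun n x => (h_ n x ^+ 2)%:E) (cst 0%E) (fun x => (G x ^+ 2)%:E).
rewrite integral0; apply => //.
- by move=> n; exact: measurable_sqr.
- move=> x _; suff : (h_ n x ^+ 2)%:E @[n --> \oo] --> 0%:E by [].
  apply/fine_cvgP; split; first exact: filterE.
  rewrite (_ : _ \o _ = (fun n => h_ n x * h_ n x)); last first.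
    by apply/funext => n /=; rewrite expr2.
  by rewrite -[0](mulr0 0); exact: cvgM.
- move=> n x _; rewrite /= lee_fin ger0_norm ?sqr_ge0//.
  by rewrite -real_normK ?num_real// lerXn2r ?nnegrE// (le_trans _ (hG n x)).
Qed.

Context (E : set (T -> R))
  (E_linear : forall (a : R) f g, E f -> E g -> E (fun x => a * f x + g x))
  (E_measurable : forall f, E f -> measurable_fun [set: T] f).

(** Membership in the closure of [E] for the [L^2] norm. *)
Definition approximable f := measurable_fun [set: T] f /\
  forall e : R, 0 < e ->
    exists2 g, E g & (sqnorm mu (fun x => (f x - g x)%R) < e%:E)%E.

Lemma approximable_sub f : E f -> approximable f.
Proof.
move=> Ef; split; first exact: E_measurable.
move=> e e0; exists f => //; rewrite /sqnorm (eq_integral (cst 0%E)).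
  by rewrite integral0 lte_fin.
by move=> x _; rewrite subrr expr0n.
Qed.

(** The constant 8 makes the total error at most half of [e], from the bound
    [(a s + t)^2 <= (2 a s)^2 + (2 t)^2]. *)
Lemma approximable_linear (a : R) f f' : approximable f -> approximable f' ->
  approximable (fun x => a * f x + f' x).
Proof.
move=> [mf fE] [mf' fE'].
have mZ (b : R) u : measurable_fun [set: T] u ->
  measurable_fun [set: T] (fun x => b * u x) by move=> mu'; exact: measurable_funM.
split; first by apply: measurable_funD => //; exact: mZ.
move=> e e0; pose k := 8 * (a ^+ 2 + 1).
have k0 : 0 < k by rewrite /k; have := sqr_ge0 a; lra.
have [|g Eg fg] := fE (e / k); first by rewrite divr_gt0.
have [|g' Eg' fg'] := fE' (e / k); first by rewrite divr_gt0.
exists (fun x => a * g x + g' x); first exact: E_linear.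
have mg := E_measurable Eg; have mg' := E_measurable Eg'.
pose u x := (2 * a) * (f x - g x); pose u' x := 2 * (f' x - g' x).
have mfg : measurable_fun [set: T] (fun x => f x - g x) by exact: measurable_funB.
have mfg' : measurable_fun [set: T] (fun x => f' x - g' x) by exact: measurable_funB.
have h : (sqnorm mu (fun x => (a * f x + f' x - (a * g x + g' x))%R) <=
    sqnorm mu u + sqnorm mu u')%E.
  apply: sqnorm_le_add; [exact: mZ|exact: mZ| |].
    by apply: measurable_funB; apply: measurable_funD => //; exact: mZ.
  move=> x; rewrite /u /u'; set s := f x - g x; set t := f' x - g' x.
  rewrite (_ : _ - _ = a * s + t); last by rewrite /s /t; ring.
  by have := sqr_ge0 (a * s - t); have := sqr_ge0 (a * s); have := sqr_ge0 t; lra.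
apply: le_lt_trans h _; rewrite !sqnormZ//.
have h1 : (((2 * a) ^+ 2)%:E * sqnorm mu (fun x => (f x - g x)%R) <=
    ((2 * a) ^+ 2 * (e / k))%:E)%E.
  by rewrite [leRHS]EFinM lee_wpmul2l ?lee_fin ?sqr_ge0// ltW.
have h2 : ((2 ^+ 2)%:E * sqnorm mu (fun x => (f' x - g' x)%R) <=
    (2 ^+ 2 * (e / k))%:E)%E.
  by rewrite [leRHS]EFinM lee_wpmul2l ?lee_fin ?sqr_ge0// ltW.
apply: le_lt_trans (leeD h1 h2) _; rewrite -EFinD lte_fin /k.
have -> : (2 * a) ^+ 2 * (e / (8 * (a ^+ 2 + 1))) +
    2 ^+ 2 * (e / (8 * (a ^+ 2 + 1))) = e / 2.
  by field; have := sqr_ge0 a; lra.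
by rewrite ltr_pdivrMr//; lra.
Qed.

Lemma approximable_lim f (f_ : nat -> T -> R) : measurable_fun [set: T] f ->
  (forall n, approximable (f_ n)) ->
  (sqnorm mu (fun x => (f x - f_ n x)%R) @[n --> \oo] --> 0)%E ->
  approximable f.
Proof.
move=> mf f_E f_f; split => // e e0; have e4 : 0 < e / 4 by rewrite divr_gt0.
have [n fn] : exists n, (sqnorm mu (fun x => (f x - f_ n x)%R) < (e / 4)%:E)%E.
  have : \forall n \near \oo, (sqnorm mu (fun x => (f x - f_ n x)%R) < (e / 4)%:E)%E.
    have lt4 : (0 < (e / 4)%:E)%E by rewrite lte_fin.
    exact: f_f _ (open_ereal_lt' lt4).
  by move=> [n _ h]; exists n; apply: h => /=.
have [mfn /(_ _ e4)[g Eg fg]] := f_E n; exists g => //.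
have mg := E_measurable Eg.
have m1 : measurable_fun [set: T] (fun x => f x - f_ n x) by exact: measurable_funB.
have m2 : measurable_fun [set: T] (fun x => f_ n x - g x) by exact: measurable_funB.
have h : (sqnorm mu (fun x => (f x - g x)%R) <=
    sqnorm mu (fun x => (Num.sqrt 2 * (f x - f_ n x))%R) +
    sqnorm mu (fun x => (Num.sqrt 2 * (f_ n x - g x))%R))%E.
  apply: sqnorm_le_add; [exact: measurable_funM|exact: measurable_funM|
    exact: measurable_funB|move=> x].
  rewrite !exprMn sqr_sqrtr//; set s := f x - f_ n x; set t := f_ n x - g x.
  rewrite (_ : f x - g x = s + t); last by rewrite /s /t; ring.
  by have := sqr_ge0 (s - t); lra.
apply: le_lt_trans h _; rewrite !sqnormZ// sqr_sqrtr//.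
have h1 : (2%:E * sqnorm mu (fun x => (f x - f_ n x)%R) < (2 * (e / 4))%:E)%E.
  by rewrite [ltRHS]EFinM lte_pmul2l// lte_fin.
have h2 : (2%:E * sqnorm mu (fun x => (f_ n x - g x)%R) < (2 * (e / 4))%:E)%E.
  by rewrite [ltRHS]EFinM lte_pmul2l// lte_fin.
apply: lt_le_trans (lteD h1 h2) _; rewrite -EFinD lee_fin; lra.
Qed.

(** Dynkin induction.  For a disjoint union, the indicators of the finite unions
    are sums, hence approximable by linearity, and converge boundedly. *)
Lemma approximable_indic (G : set (set T)) : @measurable _ T = <<s G >> ->
  setI_closed G -> approximable (cst 1) ->
  (forall A, G A -> approximable \1_A) ->
  forall A, measurable A -> approximable \1_A.
Proof.
move=> mG GI E1 EG A mA.
have E0 : approximable (fun x => 0).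
  have := approximable_linear (-1) E1 E1.
  by under eq_fun do rewrite /= mulN1r addNr.
have := mA; rewrite [X in X A]mG; move: A {mA}.
apply: dynkin_induction => //.
- by move: E1; rewrite indicT.
- move=> S mS ES; have := approximable_linear (-1) ES E1.
  congr (approximable _); apply/funext => x; rewrite !indicE in_setC.
  by case: (x \in S); rewrite /=; ring.
- move=> F mF tF EF; pose S n := \big[setU/set0]_(i < n) F i.
  have SF n x : S n x -> exists2 i, (i < n)%N & F i x.
    by rewrite /S -bigcup_mkord => -[i /= i_n Fix]; exists i.
  have FS n i x : (i < n)%N -> F i x -> S n x.
    by move=> i_n Fix; rewrite /S -bigcup_mkord; exists i.
  have SE n : approximable \1_(S n).
    elim: n => [|n IH]; first by rewrite /S big_ord0 indic0.
    have := approximable_linear 1 IH (EF n); congr approximable.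
    apply/funext => x; rewrite mul1r !indicE /S big_ord_recr /= in_setU -/(S n).
    have : ~~ ((x \in S n) && (x \in F n)).
      apply/negP => /andP[/set_mem /SF[i i_n Fix] /set_mem Fnx].
      have := tF i n I I (ex_intro _ x (conj Fix Fnx)); move: i_n => /[swap] ->.
      by rewrite ltnn.
    by case: (x \in S n); case: (x \in F n) => //= _; rewrite ?addr0 ?add0r.
  apply: (approximable_lim (f_ := fun n => \1_(S n))) => //.
    by apply: measurable_indic; exact: bigcupT_measurable.
  apply: (@sqnorm_cvg0 _ (cst 1)).
  + by move=> n; apply: measurable_funB; [apply: measurable_indic;
      exact: bigcupT_measurable|have [] := SE n].
  + under eq_fun do rewrite /= expr1n.
    exact: (finite_measure_integrable_cst mu 1).
  + move=> n x; rewrite !indicE; have [Snx|nSnx] := boolP (x \in S n).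
      rewrite mem_set ?subrr ?normr0//.
      by have [i _ Fix] := SF _ _ (set_mem Snx); exists i.
    by rewrite subr0; case: (_ \in _); rewrite ?normr1 ?normr0.
  + move=> x; apply: cvg_near_cst.
    have [[i _ Fix]|nF] := pselect ((\bigcup_k F k) x).
      near=> n; rewrite !indicE !mem_set ?subrr//; last by exists i.
      by apply: (FS _ i) => //; near: n; exact: nbhs_infty_gt.
    apply: nearW => n; rewrite !indicE !memNset ?subrr//.
    by move=> /SF[i _ Fix]; apply: nF; exists i.
Unshelve. all: by end_near. Qed.

Lemma approximable_sum (I : Type) (s : seq I) (c : I -> R) (h : I -> T -> R) :
  approximable (fun=> 0) -> (forall i, approximable (h i)) ->
  approximable (fun x => \sum_(i <- s) c i * h i x).
Proof.
move=> E0 Eh; elim: s => [|i s IH].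
  by under eq_fun do rewrite big_nil.
by under eq_fun do rewrite big_cons; exact: approximable_linear.
Qed.

Import HBNNSimple.

Lemma approximable_ge0 h : (forall A, measurable A -> approximable \1_A) ->
  measurable_fun [set: T] h -> (forall x, 0 <= h x) ->
  mu.-integrable [set: T] (fun x => (h x ^+ 2)%:E) -> approximable h.
Proof.
move=> EI mh h0 ih.
have E0 : approximable (fun=> 0) by have := EI _ measurable0; rewrite indic0.
have mEh : measurable_fun [set: T] (EFin \o h) by exact/measurable_EFinP.
pose g := nnsfun_approx measurableT mEh.
have gh x : g n x @[n --> \oo] --> h x.
  have /fine_cvgP[_] := @cvg_nnsfun_approx _ _ _ _ measurableT _ mEh
    (fun x _ => h0 x) x I.
  by [].
have gle n x : g n x <= h x.
  have nd : nondecreasing_seq (fun n => g n x).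
    by move=> m k mk; exact/lefP/nd_nnsfun_approx.
  have := nondecreasing_cvgn_le nd (cvgP _ (gh x)) n.
  by rewrite (cvg_lim _ (gh x)).
apply: (approximable_lim (f_ := fun n => g n)) => // [n|].
  have -> : (g n : T -> R) = fun x =>
      \sum_(y <- fset_set (range (g n))) y * \1_((g n) @^-1` [set y]) x.
    by apply/funext => x; rewrite fimfunE fsbig_finite.
  by apply: approximable_sum => // y; exact: EI.
apply: (@sqnorm_cvg0 _ h) => //.
- by move=> n; apply: measurable_funB.
- by move=> n x; rewrite ger0_norm ?subr_ge0// gerBl.
- by move=> x; rewrite -(subrr (h x)); apply: cvgB => //; exact: cvg_cst.
Qed.

Lemma approximable_Lfun f : (forall A, measurable A -> approximable \1_A) ->
  f \in Lfun mu 2%:E -> approximable f.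
Proof.
move=> EI f2; have mf : measurable_fun [set: T] f.
  by move: f2 => /andP[/set_mem].
have isq := Lfun2_integrable_sqr f2.
have part (u : T -> R) : measurable_fun [set: T] u ->
    (forall x, 0 <= u x <= `|f x|) -> approximable u.
  move=> mu' uf; apply: approximable_ge0 => //.
    by move=> x; have /andP[] := uf x.
  apply: le_integrable isq => //; first exact: measurable_sqr.
  move=> x _; have /andP[u0 ux] := uf x.
  rewrite /= lee_fin !ger0_norm ?sqr_ge0// -[leRHS]real_normK ?num_real//.
  by rewrite lerXn2r ?nnegrE.
have -> : f = fun x => -1 * f^\- x + f^\+ x.
  apply/funext => x; rewrite /funrpos /funrneg.
  by case: (leP 0 (f x)); case: (leP 0 (- f x)); lra.
apply: approximable_linear; apply: part.
- exact: measurable_funrneg.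
- by move=> x; rewrite /funrneg le_max lexx orbT ge_max normr_ge0 -normrN ler_norm.
- exact: measurable_funrpos.
- by move=> x; rewrite /funrpos le_max lexx orbT ge_max normr_ge0 ler_norm.
Qed.

End square_approximation.
Section step_density.
Context {R : realType} {C : ptopologicalType} {d : C -> C -> R}.
Context (hC : cantor_set R C) (hd : regular_ultrametric d).
Context (mu : probability (borel C) R).
Implicit Types (f g : C -> R).

Lemma step_linear (a : R) f g : step_space d f -> step_space d g ->
  step_space d (fun x => a * f x + g x).
Proof.
move=> /(step_spaceP hC hd) lf /(step_spaceP hC hd) lg; apply/(step_spaceP hC hd).
exact: (locally_constant2 (fun s t => a * s + t)).
Qed.

(** Two points at distance less than [e] have the same ball of radius [e]. *)
Lemma step_indic_interior (U : set C) (e : R) : 0 < e ->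
  step_space d (\1_[set x | dball d x e `<=` U]).
Proof.
move=> e0; apply/(step_spaceP hC hd); exists e => // x y xy.
by rewrite !indicE; congr (nat_of_bool _)%:R; apply/idP/idP => /set_mem /= h;
  apply/mem_set => /=; rewrite ?(dball_recenter hd xy)//
  -?(dball_recenter hd xy)//.
Qed.

Lemma approximable_step_open (U : set C) : open U ->
  approximable mu (step_space d) (\1_U : borel C -> R).
Proof.
move=> oU; have [[_ dtop] _] := hd.
pose W n : set C := [set x | dball d x (n.+1%:R^-1) `<=` U].
have n0 (n : nat) : 0 < n.+1%:R^-1 :> R by rewrite invr_gt0.
have WU n : W n `<=` U by move=> x; apply; exact: (dball_center hd).
have mW n : measurable_fun [set: borel C] (\1_(W n) : borel C -> R).
  by apply: (measurable_step hd); exact: step_indic_interior.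
have mU : measurable_fun [set: borel C] (\1_U : borel C -> R).
  by apply: measurable_indic; exact: open_measurable_borel.
have ms g : step_space d g -> measurable_fun [set: borel C] (g : borel C -> R).
  exact: (measurable_step hd).
have := @approximable_lim _ (borel C) R mu (step_space d) ms (\1_U)
  (fun n => \1_(W n)) mU.
apply.
  move=> n; apply: (@approximable_sub _ (borel C) R mu (step_space d) ms).
  exact: step_indic_interior.
apply: (@sqnorm_cvg0 _ (borel C) R mu _ (cst 1)).
- by move=> n; exact: measurable_funB.
- under eq_fun do rewrite /= expr1n.
  exact: (finite_measure_integrable_cst mu 1).
- move=> n x; rewrite !indicE; have [Wx|_] := boolP (x \in W n).
    by rewrite mem_set ?subrr ?normr0//; apply: (WU n); exact: set_mem.
  by rewrite subr0; case: (_ \in _); rewrite ?normr1 ?normr0.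
- move=> x; apply: cvg_near_cst.
  have [Ux|nUx] := pselect (U x); last first.
    apply: nearW => n; rewrite !indicE !memNset ?subrr//.
    by move=> /WU.
  have [e e0 eU] : exists2 e : R, 0 < e & dball d x e `<=` U.
    by apply/dtop; apply: open_nbhs_nbhs.
  near=> n; rewrite !indicE !mem_set ?subrr// => y xy; apply: eU.
  apply: lt_trans xy _; near: n; exact: near_infty_natSinv_lt (PosNum e0).
Unshelve. all: by end_near. Qed.

Lemma step_dense f : f \in Lfun (mu : {measure set (borel C) -> \bar R}) 2%:E ->
  forall e : R, 0 < e -> exists2 g, step_space d g &
    ('N[mu]_2%:E[EFin \o (fun x => f x - g x)%R] < e%:E)%E.
Proof.
move=> f2 e e0.
have ms g : step_space d g -> measurable_fun [set: borel C] (g : borel C -> R).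
  exact: (measurable_step hd).
have EI (A : set (borel C)) : measurable A ->
    approximable mu (step_space d) (\1_A : borel C -> R).
  apply: (@approximable_indic _ (borel C) R mu (step_space d) step_linear ms
    (@open C)) => //.
  - by move=> U W; exact: openI.
  - apply: (@approximable_sub _ (borel C) R mu (step_space d) ms).
    apply/(step_spaceP hC hd).
    exact: locally_constant_cst.
  - exact: approximable_step_open.
have [_ h] := @approximable_Lfun _ (borel C) R mu (step_space d) step_linear ms
  f EI f2.
have [g sg fg] := h (e ^+ 2) (exprn_gt0 _ e0).
by exists g => //; rewrite Lnorm2_lt.
Qed.

Lemma step_Lfun f : step_space d f ->
  f \in Lfun (mu : {measure set (borel C) -> \bar R}) 2%:E.
Proof.
move=> sf; have mf := measurable_step hd sf.
have [M Mf] := step_bounded sf.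
have M0 : 0 <= M by apply: le_trans (Mf point).
apply/andP; split; first exact/mem_set.
apply/mem_set; rewrite /= /finite_norm; apply: (@lt_trans _ _ (M + 1)%:E); last exact: ltry.
rewrite Lnorm2_lt; last by lra.
apply: (@le_lt_trans _ _ (M ^+ 2)%:E); last by rewrite lte_fin; nra.
have -> : ((M ^+ 2)%:E = \int[mu]_x (cst (M ^+ 2)%:E) x)%E.
  rewrite integral_cst//; apply: etrans (esym (mule1 _)) _.
  by congr (_ * _)%E; apply: esym; exact: probability_setT.
apply: ge0_le_integral => //.
- by move=> x _; rewrite lee_fin sqr_ge0.
- exact: measurable_sqr.
- move=> x _; rewrite lee_fin -real_normK ?num_real//.
  by rewrite lerXn2r ?nnegrE.
Qed.

End step_density.
(** * The Dirichlet form *)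

Lemma clamp_contraction (R : realDomainType) (a b : R) :
  `|Num.min (Num.max 0 a) 1 - Num.min (Num.max 0 b) 1| <= `|a - b|.
Proof.
have key (t : R) : [\/ t <= 0 /\ Num.min (Num.max 0 t) 1 = 0,
    (0 <= t <= 1) /\ Num.min (Num.max 0 t) 1 = t |
    1 <= t /\ Num.min (Num.max 0 t) 1 = 1].
  have [t0|t0] := leP t 0; first by constructor 1; rewrite min_l.
  have [t1|t1] := leP t 1; last by constructor 3; rewrite ltW.
  by constructor 2; rewrite ltW.
have [] := key a => -[ha ->]; have [] := key b => -[hb ->];
  rewrite ler_norml; have := ler_norm (a - b); have := ler_norm (b - a);
  rewrite distrC => h1 h2; apply/andP; split; lra.
Qed.

Section dirichlet_form.
Context {R : realType} {C : ptopologicalType} {d : C -> C -> R}.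
Context (hC : cantor_set R C) (hd : regular_ultrametric d).
Context (mu : probability (borel C) R).
Context (hmass : forall v : vertex d, nu_mass mu v != 0%E).
Context (nu : probability (UpsilonM hC hd) R).
Context (nuP : is_nu mu nu).
Implicit Types (v w : vertex d) (f g h : C -> R) (l : seq (vertex d)).

(** The contribution of the vertices of [l] to the form.  It makes sense for all
    lists, and for a given pair of step functions it equals the form as soon as
    the list is large enough. *)
Definition level_form (s : R) l f g : R :=
  \sum_(v <- l) weight s v * jump_form nu v f g.

Definition form_trace (s : R) f g (tau : choice_fun d) : R[i] :=
  trace (form_op s tau (fun x => (f x)%:C) (fun x => (g x)%:C)).

Definition energy_form (s : R) f g : R :=
  complex.Re (2^-1 * cintegral nu (form_trace s f g)).

Lemma integral_jump_sum s l f g : step_space d f -> step_space d g ->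
  nu.-integrable [set: UpsilonM hC hd] (EFin \o (fun tau : UpsilonM hC hd =>
    \sum_(v <- l) weight s v *
      (jump f ((tau : choice_fun d) v) * jump g ((tau : choice_fun d) v)))) /\
  \int[nu]_(tau in [set: UpsilonM hC hd]) (\sum_(v <- l) weight s v *
      (jump f ((tau : choice_fun d) v) * jump g ((tau : choice_fun d) v))) =
  level_form s l f g.
Proof.
move=> sf sg; rewrite /level_form; elim: l => [|v l [IHi IHe]].
  under [X in _.-integrable _ (_ \o X)]eq_fun do rewrite big_nil.
  under eq_Rintegral do rewrite big_nil.
  rewrite big_nil; split; first exact: (finite_measure_integrable_cst nu 0).
  by rewrite Rintegral_cst// mul0r.
have iv := integrable_jump nu v sf sg.
have iZ : nu.-integrable [set: UpsilonM hC hd] (EFin \o (fun tau : UpsilonM hC hd =>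
    weight s v * (jump f ((tau : choice_fun d) v) * jump g ((tau : choice_fun d) v)))).
  by apply: eq_integrable (integrableZl measurableT (weight s v) iv).
under [X in _.-integrable _ (_ \o X)]eq_fun do rewrite big_cons.
under eq_Rintegral do rewrite big_cons.
split.
  by apply: eq_integrable (integrableD measurableT iZ IHi).
by rewrite RintegralD// RintegralZl// IHe big_cons.
Qed.

Lemma form_traceE s f g e l : constant_at_scale d e g -> uniq l ->
  (forall v, v \notin l -> diam v < e) ->
  form_trace s f g = fun tau =>
    (2 * \sum_(v <- l) weight s v * (jump f (tau v) * jump g (tau v)))%:C.
Proof.
move=> ge ul le; apply/funext => tau; rewrite /form_trace.
by have [_ ->] := trace_form s tau f ge ul le.
Qed.

Lemma form_integral s f g e l : step_space d f -> step_space d g ->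
  constant_at_scale d e g -> uniq l -> (forall v, v \notin l -> diam v < e) ->
  cintegrable nu (form_trace s f g) /\
  2^-1 * cintegral nu (form_trace s f g) = (level_form s l f g)%:C.
Proof.
move=> sf sg ge ul le; rewrite (form_traceE _ _ ge ul le).
have [ji jE] := integral_jump_sum s l sf sg.
split.
  split; rewrite /=.
    by apply: eq_integrable (integrableZl measurableT 2 ji).
  exact: (finite_measure_integrable_cst nu 0).
rewrite /cintegral /= RintegralZl// jE Rintegral_cst// mul0r.
rewrite -[_ +i* _]/((2 * level_form s l f g)%:C) -(rmorph_nat (real_complex R) 2).
by rewrite -fmorphV -rmorphM mulKf.
Qed.

(** All that the trace formula says about the second argument [f], in terms of
    any list that contains the vertices of diameter at least the scale of [f].
    The freedom in [l] makes it possible to compare the forms of several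
    functions on a common list. *)
Lemma exists_levels f : step_space d f -> exists l0, forall l, uniq l ->
  {subset l0 <= l} -> forall s g, step_space d g ->
   [/\ energy_form s g f = level_form s l g f,
       cintegrable nu (form_trace s g f),
       2^-1 * cintegral nu (form_trace s g f) = (energy_form s g f)%:C &
       forall tau : choice_fun d, trace_summable
         (form_op s tau (fun x => (g x)%:C) (fun x => (f x)%:C))].
Proof.
move=> sf; have [e e0 fe] := (step_spaceP hC hd f).1 sf.
have [l0 [_ l0e]] := exists_large_vertices hC hd e0; exists l0 => l ul l0l s g sg.
have le v : v \notin l -> diam v < e.
  by move=> vl; apply: l0e; apply: contraNN vl; exact: l0l.
have [ci cE] := form_integral s sg sf fe ul le.
have eE : energy_form s g f = level_form s l g f by rewrite /energy_form cE.
split => //; first by rewrite eE.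
by move=> tau; have [] := trace_form s tau g fe ul le.
Qed.

Lemma energy_formE s f g : step_space d f -> step_space d g ->
  exists l0, forall l, uniq l -> {subset l0 <= l} ->
    [/\ energy_form s f f = level_form s l f f,
        energy_form s f g = level_form s l f g,
        energy_form s g f = level_form s l g f &
        energy_form s g g = level_form s l g g].
Proof.
move=> sf sg; have [lf lfE] := exists_levels sf; have [lg lgE] := exists_levels sg.
exists (lf ++ lg) => l ul sub.
have subf : {subset lf <= l} by move=> v vl; apply: sub; rewrite mem_cat vl.
have subg : {subset lg <= l} by move=> v vl; apply: sub; rewrite mem_cat vl orbT.
have [-> _ _ _] := lfE l ul subf s f sf; have [-> _ _ _] := lfE l ul subf s g sg.
by have [-> _ _ _] := lgE l ul subg s f sf; have [-> _ _ _] := lgE l ul subg s g sg.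
Qed.

Lemma level_formC s l f g : level_form s l f g = level_form s l g f.
Proof. by apply: eq_bigr => v _; rewrite jump_formC. Qed.

Lemma level_form_linear s l (a : R) f f' g : step_space d f -> step_space d f' ->
  step_space d g ->
  level_form s l (fun x => a * f x + f' x) g =
  a * level_form s l f g + level_form s l f' g.
Proof.
move=> sf sf' sg; rewrite /level_form mulr_sumr -big_split /=.
by apply: eq_bigr => v _; rewrite jump_form_linear//; ring.
Qed.

Lemma level_form_ge0 s l f : 0 <= level_form s l f f.
Proof. by apply: sumr_ge0 => v _; rewrite mulr_ge0 ?weight_ge0 ?jump_form_ge0. Qed.

Lemma level_form_le s l f g : step_space d f -> step_space d g ->
  (forall x y, `|f x - f y| <= `|g x - g y|) ->
  level_form s l f f <= level_form s l g g.
Proof.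
move=> sf sg fg; apply: ler_sum => v _; rewrite ler_wpM2l ?weight_ge0//.
exact: jump_form_le.
Qed.

(** The form is a sum of nonnegative terms, so it dominates all its finite
    parts. *)
Lemma level_form_le_energy s l f : uniq l -> step_space d f ->
  level_form s l f f <= energy_form s f f.
Proof.
move=> ul sf; have [l0 l0E] := energy_formE s sf sf.
pose k := undup (l0 ++ l).
have [||-> _ _ _] := l0E k; first exact: undup_uniq.
  by move=> v vl; rewrite mem_undup mem_cat vl.
rewrite /level_form [leRHS](bigID (mem l) predT) /=.
rewrite [X in _ <= X + _](_ : _ = \sum_(v <- l) weight s v * jump_form nu v f f).
  rewrite lerDl; apply: sumr_ge0 => v _.
  by rewrite mulr_ge0 ?weight_ge0 ?jump_form_ge0.
rewrite -big_filter; apply: perm_big; apply: uniq_perm => //.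
  by rewrite filter_uniq ?undup_uniq.
by move=> v; rewrite mem_filter mem_undup mem_cat; case: (v \in l); rewrite ?orbT.
Qed.

Lemma level_form_bound s l : exists2 K : R, 0 <= K &
  forall f, step_space d f ->
    ((level_form s l f f)%:E <= K%:E * sqnorm mu (f : borel C -> R))%E.
Proof.
elim: l => [|v l [K K0 KP]].
  by exists 0 => // f sf; rewrite /level_form big_nil mul0e.
have [K' K'0 K'P] := jump_form_bound hmass nuP v.
have wK : 0 <= weight s v * K' by apply: mulr_ge0 => //; exact: weight_ge0.
exists (weight s v * K' + K); first exact: addr_ge0.
move=> f sf; rewrite /level_form big_cons EFinD [X in (_ <= X * _)%E]EFinD.
rewrite ge0_muleDl ?lee_fin//; apply: leeD; last exact: KP.
rewrite [X in (X <= _)%E]EFinM [X in (_ <= X * _)%E]EFinM -muleA.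
by rewrite lee_wpmul2l ?lee_fin ?weight_ge0//; exact: K'P.
Qed.

(** From [f = (f - g) + g] and the nonnegativity of the form at
    [(f - g) - g]. *)
Lemma level_form_triangle s l f g : step_space d f -> step_space d g ->
  level_form s l f f <=
  2 * level_form s l (fun x => f x - g x) (fun x => f x - g x) +
  2 * level_form s l g g.
Proof.
move=> sf sg; pose u x := f x - g x.
have su : step_space d u.
  by have := step_linear hC hd (-1) sg sf; congr step_space; apply/funext => x;
    rewrite /u; ring.
have expand a : level_form s l (fun x => a * g x + u x) (fun x => a * g x + u x) =
    a ^+ 2 * level_form s l g g + 2 * a * level_form s l u g + level_form s l u u.
  have sa : step_space d (fun x => a * g x + u x) by exact: step_linear.
  rewrite level_form_linear// (level_formC _ _ g) (level_formC _ _ u).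
  by rewrite !level_form_linear// (level_formC s l g u); ring.
have := level_form_ge0 s l (fun x => -1 * g x + u x).
have -> : level_form s l f f = level_form s l (fun x => 1 * g x + u x)
    (fun x => 1 * g x + u x).
  by congr level_form; apply/funext => x; rewrite /u; ring.
rewrite !expand -/u; lra.
Qed.

Lemma step_sub f g : step_space d f -> step_space d g ->
  step_space d (fun x => f x - g x).
Proof.
move=> sf sg; have := step_linear hC hd (-1) sg sf.
by congr step_space; apply/funext => x; ring.
Qed.

(** For a fixed large [n], the form at [f_ n] is its part over a finite list [l]
    that depends on [n].  By [level_form_triangle] it is at most twice the part
    over [l] of the form at [f_ n - f_ m], small for all large [m] by the Cauchy
    condition, plus twice the part over [l] of the form at [f_ m], which tends
    to 0 with [m] because it is bounded by the squared norm of [f_ m].  The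
    bound depends on [l], so [m] has to be chosen after [n]. *)
Lemma energy_closable s (f_ : nat -> (C -> R)) :
  (forall n, step_space d (f_ n)) ->
  ('N[mu]_2%:E[EFin \o (f_ n : borel C -> R)] @[n --> \oo] --> 0)%E ->
  energy_form s (fun x => f_ p.1 x - f_ p.2 x) (fun x => f_ p.1 x - f_ p.2 x)
    @[p --> (\oo, \oo)] --> 0 ->
  energy_form s (f_ n) (f_ n) @[n --> \oo] --> 0.
Proof.
move=> sf f0 Qf0; apply/cvgrPdist_lt => e e0.
have e8 : 0 < e / 8 by rewrite divr_gt0.
have [[A B] [[n1 _ n1A] [n2 _ n2B]] AB] : \forall p \near (\oo, \oo),
    energy_form s (fun x => f_ p.1 x - f_ p.2 x) (fun x => f_ p.1 x - f_ p.2 x)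
      < e / 8 by apply: cvgr_lt Qf0 _ e8.
exists (maxn n1 n2) => // n /= nn.
have [l0 l0E] := energy_formE s (sf n) (sf n).
pose l := undup l0; have ul : uniq l by exact: undup_uniq.
have [|-> _ _ _] := l0E l ul; first by move=> v; rewrite mem_undup.
rewrite sub0r normrN ger0_norm; last exact: level_form_ge0.
(* The radius [r] is chosen so that [K * r ^+ 2 <= e / 8]. *)
have [K K0 KP] := level_form_bound s l.
pose r := Num.sqrt (e / (8 * (K + 1))).
have k0 : 0 < e / (8 * (K + 1)) by rewrite divr_gt0//; lra.
have r0 : 0 < r by rewrite sqrtr_gt0.
have [m nm fm] : exists2 m, (maxn n1 n2 <= m)%N &
    ('N[mu]_2%:E[EFin \o (f_ m : borel C -> R)] < r%:E)%E.
  have r0' : (0 < r%:E)%E by rewrite lte_fin.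
  have [N _ Nr] := f0 _ (open_ereal_lt' r0').
  exists (maxn N (maxn n1 n2)); first exact: leq_maxr.
  by apply: Nr => /=; exact: leq_maxl.
move: fm; rewrite Lnorm2_lt// sqr_sqrtr ?ltW// => fm.
apply: le_lt_trans (level_form_triangle s l (sf n) (sf m)) _.
have h1 : level_form s l (fun x => f_ n x - f_ m x) (fun x => f_ n x - f_ m x) < e / 8.
  apply: le_lt_trans (level_form_le_energy s ul (step_sub (sf n) (sf m))) _.
  apply: (AB (n, m)); split => /=.
    by apply: n1A => /=; apply: leq_trans nn; exact: leq_maxl.
  by apply: n2B => /=; apply: leq_trans nm; exact: leq_maxr.
have h2 : level_form s l (f_ m) (f_ m) <= e / 8.
  rewrite -lee_fin; apply: le_trans (KP _ (sf m)) _.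
  apply: (@le_trans _ _ (K%:E * (e / (8 * (K + 1)))%:E)%E).
    by rewrite lee_wpmul2l ?lee_fin// ltW.
  rewrite -EFinM lee_fin.
  have -> : K * (e / (8 * (K + 1))) = e / 8 * (K / (K + 1)) by field; lra.
  by apply: ler_piMr; [exact: ltW|rewrite ler_pdivrMr; lra].
lra.
Qed.

(** If the functions differ at [x], they differ on a whole ball around [x], which
    is a vertex and has positive mass. *)
Lemma step_ae_eq f f' : step_space d f -> step_space d f' ->
  {ae mu, forall x : borel C, f x = f' x} -> f = f'.
Proof.
move=> sf sf' [N [mN N0 fN]]; apply/funext => x; apply: contrapT => ff'.
have [e e0 fe] := (step_spaceP hC hd _).1 (step_sub sf sf').
have [w wE] := @exists_vertex R C d x e e0.
have := shadow_mass_gt0 hC hd hmass w; rewrite lt_neqAle => /andP[/eqP + _]; apply.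
apply/esym/eqP; rewrite eq_le measure_ge0 andbT -N0.
apply: le_measure; [apply/mem_set; exact: (measurable_shadow hd)|exact/mem_set|].
rewrite wE => y xy; apply: fN => /= fy; apply: ff'.
by have := fe _ _ xy; rewrite fy subrr => /eqP; rewrite subr_eq0 => /eqP.
Qed.

Lemma energy_closable_dirichlet_form s :
  closable_dirichlet_form (T := borel C) mu (step_space d) (energy_form s).
Proof.
split.
- exact: (step_Lfun hd mu).
- by apply/(step_spaceP hC hd); exact: locally_constant_cst.
- exact: (step_linear hC hd).
- by move=> f f2 e e0; have [g sg fg] := step_dense hC hd f2 e0; exists g.
- by move=> f f' g sf sf' sg /(step_ae_eq sf sf') ->.
- move=> f g sf sg; have [l0 /(_ _ (undup_uniq l0))[|_ -> -> _]] := energy_formE s sf sg.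
    by move=> v; rewrite mem_undup.
  exact: level_formC.
- move=> a f f' g sf sf' sg; have [l0 l0E] := exists_levels sg.
  have {}l0E h : step_space d h -> energy_form s h g = level_form s (undup l0) h g.
    have sub : {subset l0 <= undup l0} by move=> v; rewrite mem_undup.
    by move=> sh; have [] := l0E _ (undup_uniq l0) sub s h sh.
  rewrite !l0E//; last exact: step_linear.
  exact: level_form_linear.
- move=> f sf; have [l0 /(_ _ (undup_uniq l0))[|-> _ _ _]] := energy_formE s sf sf.
    by move=> v; rewrite mem_undup.
  exact: level_form_ge0.
- exact: energy_closable.
- move=> f sf ft.
  have sft : step_space d ft.
    apply/(step_spaceP hC hd).
    apply: (locally_constant_comp (fun t : R => Num.min (Num.max 0 t) 1)).
    exact/(step_spaceP hC hd).
  split; first exact: sft.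
  have [l0 /(_ _ (undup_uniq l0))[|-> _ _ ->]] := energy_formE s sf sft.
    by move=> v; rewrite mem_undup.
  apply: level_form_le => // x y; exact: clamp_contraction.
Qed.

End dirichlet_form.
Theorem theorem4 (R : realType) (C : ptopologicalType) (d : C -> C -> R)
    (hC : cantor_set R C) (hd : regular_ultrametric d)
    (hzeta : zeta_regular d)
    (mu : probability (borel C) R) (hmu : zeta_measure d mu)
    (hmass : forall v : vertex d, nu_mass mu v != 0%E) :
  exists nu : probability (UpsilonM hC hd) R,
    [/\ is_nu mu nu,
        forall nu' : probability (UpsilonM hC hd) R, is_nu mu nu' ->
          forall X, measurable X -> nu' X = nu X &
        forall s : R,
          (forall f g : C -> R, step_space d f -> step_space d g ->
             (forall tau : choice_fun d,
                trace_summable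
                  (form_op s tau (fun x => (f x)%:C) (fun x => (g x)%:C))) /\
             cintegrable nu (fun tau : choice_fun d =>
               trace (form_op s tau (fun x => (f x)%:C) (fun x => (g x)%:C)))) /\
          exists Q : (C -> R) -> (C -> R) -> R,
            (forall f g : C -> R, step_space d f -> step_space d g ->
               (Q f g)%:C = 2^-1 * cintegral nu (fun tau : choice_fun d =>
                 trace (form_op s tau (fun x => (f x)%:C)
                                      (fun x => (g x)%:C)))) /\
            closable_dirichlet_form (T := borel C) mu (step_space d) Q].
Proof.
have [nu nuP] := exists_nu hC hd hmass.
exists nu; split => // [nu' nu'P|s]; first exact: (nu_unique nuP nu'P).
have facts (f g : C -> R) (sf : step_space d f) (sg : step_space d g) :
    [/\ cintegrable nu (form_trace s f g),
        2^-1 * cintegral nu (form_trace s f g) = (energy_form nu s f g)%:C &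
        forall tau : choice_fun d, trace_summable
          (form_op s tau (fun x => (f x)%:C) (fun x => (g x)%:C))].
  have [l0 l0E] := exists_levels nu sg.
  have sub : {subset l0 <= undup l0} by move=> v; rewrite mem_undup.
  by have [] := l0E _ (undup_uniq l0) sub s f sf.
split; first by move=> f g sf sg; have [] := facts f g sf sg.
exists (energy_form nu s); split; last exact: energy_closable_dirichlet_form.
by move=> f g sf sg; have [_ -> _] := facts f g sf sg.
Qed.
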